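(* Assume $\operatorname{char}\Bbbk\neq2$, $N\ge2$ and $1\le i\le N-1$. For each finitely supported sequence $\{\sigma_\ell\}_{\ell\ge0}\in\Bbbk^{\mathbb Z_{\ge0}}=\bigoplus_{\ell\ge0}\Bbbk$, the formulas $$\eta^1(a_{kj}s^\alpha)=\begin{cases}\mathfrak q(a_{kj}s^\alpha)\sum_{\ell=0}^\infty\frac12\sigma_\ell\,a_{kj}s^{\alpha+\ell},&k\ne i,\\[2pt] \mathfrak q(a_{ij}s^\alpha)\sum_{\ell=0}^\infty\frac12\sigma_\ell\,a_{i+\operatorname{sgn}(j-i),j}s^{\alpha+\ell},&k=i\ne j,\\[2pt] \mathfrak q(s_i^\alpha)\sum_{\ell=0}^\infty\frac12\sigma_\ell\,\big[\tfrac12q_{i-1}s^{\alpha+\ell-1},\ \tfrac12p_{i+1}s^{\alpha+\ell-1}\big],&k=j=i,\end{cases}$$ $$\eta^2(a_{lk}s^\beta,a_{kj}s^\alpha)=\begin{cases}0,&l\ne i,\\ \mathfrak Q(a_{ik}s^\beta,a_{kj}s^\alpha)\sum_{\ell=0}^\infty\frac12\sigma_\ell\,a_{ij}s^{\beta+\alpha+\delta(j,k,i)+\ell-1},&l=i,\end{cases}$$ and $\eta^0=\eta^3=\eta^4=\cdots=0$, define a degree $1$ $A_\infty$-natural transformation $\eta_{\{\sigma_\ell\}}:\mathrm{id}\Rightarrow\beta_{i^-}$. Here $\mathfrak q(a_{kj}s^\alpha)=2\alpha+|j-k|$, and for $a_2=a_{ik}s^\beta$, $a_1=a_{kj}s^\alpha$,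 $$\mathfrak Q(a_2,a_1)=\begin{cases}\operatorname{sgn}(i-k)\,\mathfrak q(a_2a_1),&k<i<j\text{ or }j<i<k,\\ \operatorname{sgn}(j-i)\,\tfrac12\mathfrak q(a_2),&k=i,\\ \operatorname{sgn}(i-k)\,\tfrac12\mathfrak q(a_2a_1),&j=i,\\0,&\text{else}.\end{cases}$$ (If $\beta+\alpha+\delta(j,k,i)=0$ then $\mathfrak Q=0$, and $\mathfrak q(s_i^0)=0$, so terms with $s^{-1}$ are read as $0$.) These represent all cohomology classes of degree $1$ natural transformations exactly once: $\{\sigma_\ell\}\mapsto[\eta_{\{\sigma_\ell\}}]$ is an isomorphism $\Bbbk^{\mathbb Z_{\ge0}}\cong\mathrm{HH}^1(\mathfrak B_{i^-})=H^1\operatorname{Hom}(\mathrm{id},\beta_{i^-})$. The values $\eta^1(\cdot)$ for $k=i$ are degree $0$ morphisms $T_j\to\beta_{i^-}T_i$ into the degree $0$ term $T_{i-1}\oplus T_{i+1}$ (with $[x,y]$ having components $x:T_i\to T_{i-1}$, $y:T_i\to T_{i+1}$, and $a_{i\pm1,j}s^{\alpha+\ell}$ landing in the summand $T_{i\pm1}$), and the values of $\eta^2$ for $l=i$ are degree $-1$ morphisms $T_j\to\beta_{i^-}T_i$ into the degree $-1$ term $T_i$.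
   Context: Let $\Bbbk$ be a field. $\mathcal C$ is the $\Bbbk$-linear category (concentrated in degree $0$, only $\mu^2$ nonzero) with objects $T_0,\dots,T_N$, where $\operatorname{Hom}(T_i,T_j)$ has $\Bbbk$-basis $\{a_{ji}s^\alpha\}_{\alpha\ge0}$ and composition $a_{kj}s^\beta\cdot a_{ji}s^\alpha=a_{ki}s^{\alpha+\beta+\delta(i,j,k)}$, $\delta(i,j,k)=\frac12(|i-j|+|j-k|-|i-k|)$. Notation: $s_i^\alpha=a_{ii}s^\alpha$, $p_i=a_{i,i-1}$, $q_i=a_{i,i+1}$, $q_{i-1}s^\alpha=a_{i-1,i}s^\alpha$, $p_{i+1}s^\alpha=a_{i+1,i}s^\alpha$; $\operatorname{sgn}(0)=0$. $\mathrm{Tw}^b(\mathcal C)$ is the category of bounded complexes over $\mathcal C$: objects carry a differential $\delta$, morphisms are graded matrices of morphisms, $\mu^1_\delta(x)=(-1)^{|x|}\delta x-x\delta$, $\mu^2_\delta(x_2,x_1)=(-1)^{|x_1|}x_2x_1$ (naive products on the right), and $\mu_\delta^{d}=0$ for $d\geq3$. The negative braiding functor $\beta_{i^-}:\mathcal C\to\mathrm{Tw}^b(\mathcal C)$ (extended to $\mathrm{Tw}^b(\mathcal C)$) is the following $A_\infty$-functor. Objects: $\beta_{i^-}T_j=T_j$ for $j\ne i$; $\beta_{i^-}T_i=\big(T_i\xrightarrow{[q_{i-1},\,-p_{i+1}]}T_{i-1}\oplus T_{i+1}\big)$ with $T_i$ in degree $-1$ and $T_{i-1}\oplus T_{i+1}$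 in degree $0$. First component $\beta_{i^-}^1$ (degree $0$): (a) $a_{kj}s^\alpha\mapsto a_{kj}s^\alpha$ if $j,k\ne i$; (b) $a_{ij}s^\alpha$ with $j>i$ (resp. $j<i$) maps to $a_{i+1,j}s^\alpha:T_j\to T_{i+1}$ (resp. $a_{i-1,j}s^\alpha:T_j\to T_{i-1}$); (c) $a_{ki}s^\alpha$ with $k>i$ maps to the morphism with components $a_{k,i-1}s^\alpha$ on $T_{i-1}$ and $a_{k,i+1}s^{\alpha+1}$ on $T_{i+1}$, and with $k<i$ to the morphism with components $a_{k,i-1}s^{\alpha+1}$ on $T_{i-1}$ and $a_{k,i+1}s^\alpha$ on $T_{i+1}$; (d) $s_i^\alpha$ maps to the diagonal morphism with entries $s_i^\alpha,s_{i-1}^\alpha,s_{i+1}^\alpha$. Second component $\beta_{i^-}^2(a_{lk}s^\beta,a_{kj}s^\alpha)$ (degree $-1$): it is $0$ if $l\neq i$; if $l=i\ne j$ it is $0$ when $(i-j)(i-k)\ge0$, and $\operatorname{sgn}(i-k)a_{ij}s^{\beta+\alpha+|i-k|-1}$ into the degree $-1$ term $T_i$ when $(i-j)(i-k)<0$; if $l=j=i$ it is $\operatorname{sgn}(i-k)\,a_{i,i+\operatorname{sgn}(i-k)}s^{\beta+\alpha+|i-k|-1}$ from the summand $T_{i+\operatorname{sgn}(i-k)}$ of the degree $0$ term to the degree $-1$ term $T_i$ (so $0$ if $k=i$). $\beta_{i^-}^d=0$ for $d\ge3$. The associated $(\mathcal C,\mathcal C)$-bimodule is denoted $\mathfrak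 B_{i^-}$. A degree $g$ pre-natural transformation $\eta:\mathrm{id}\Rightarrow\beta_{i^-}$ consists of multilinear maps $\eta^d:\operatorname{Hom}(X_{d-1},X_d)\otimes\cdots\otimes\operatorname{Hom}(X_0,X_1)\to\operatorname{Hom}^{g-d}(X_0,\beta_{i^-}X_d)$, $d\ge0$, on objects $X_m$ of $\mathcal C$. The differential is $$\begin{aligned}\mu^1(\eta)^d(a_d,\dots,a_1)=\;&\mu^1_\delta\big(\eta^d(a_d,\dots,a_1)\big)+\sum_{m=0}^{d-1}\mu^2_\delta\big(\beta_{i^-}^{d-m}(a_d,\dots,a_{m+1}),\eta^m(a_m,\dots,a_1)\big)\\&+(-1)^{g-1}\mu^2_\delta\big(\eta^{d-1}(a_d,\dots,a_2),a_1\big)-\sum_{n=0}^{d-2}(-1)^{n+g-1}\eta^{d-1}(a_d,\dots,a_{n+2}\cdot a_{n+1},\dots,a_1)\end{aligned}$$ (terms with $\eta^{d-1}$ absent for $d=0$). $\eta$ is an $A_\infty$-natural transformation if $\mu^1(\eta)=0$; $\mathrm{HH}^g(\mathfrak B_{i^-})=H^g\operatorname{Hom}(\mathrm{id},\beta_{i^-})$ is the degree-$g$ cohomology of this complex. *)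

(* Defs.v *)
From HB Require Import structures.
From mathcomp Require Import all_boot all_order all_algebra.
From mathcomp Require Import boolp.

Set Implicit Arguments.
Unset Strict Implicit.
Unset Printing Implicit Defensive.

Import Order.TTheory GRing.Theory Num.Theory.

Local Open Scope ring_scope.
Local Open Scope quotient_scope.

(* The quotient of a K-module by a submodule: ring_quotient only provides the
   underlying additive group. *)
Section LmodQuotient.
Variables (K : comNzRingType) (V : lmodType K).
Variables (S : {pred V}) (S_submod : submod_closed S).

Definition submod_pred of submod_closed S : {pred V} := S.
HB.instance Definition _ :=
  GRing.isSubmodClosed.Build K V (submod_pred S_submod) S_submod.

Definition lmod_quot := Quotient.quot (submod_pred S_submod).
HB.instance Definition _ := GRing.Zmodule.on lmod_quot.
HB.instance Definition _ := EqQuotient.on lmod_quot.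

Definition lmod_quot_scale (t : K) : lmod_quot -> lmod_quot :=
  lift_op1 lmod_quot ( *:%R t).

Lemma pi_lmod_scale t : {morph \pi_lmod_quot : x / t *: x >-> lmod_quot_scale t x}.
Proof.
move=> x; unlock lmod_quot_scale; apply/eqP.
rewrite -Quotient.idealrBE -scalerBr rpredZ //.
by rewrite Quotient.idealrBE reprK.
Qed.

Lemma pi_lmod_add : {morph \pi_lmod_quot : x y / x + y}.
Proof. by move=> x y; rewrite !piE. Qed.

Fact lmod_quot_scaleA a b v :
  lmod_quot_scale a (lmod_quot_scale b v) = lmod_quot_scale (a * b) v.
Proof. by elim/quotW: v => x; rewrite -!pi_lmod_scale scalerA. Qed.

Fact lmod_quot_scale1 : left_id 1 lmod_quot_scale.
Proof. by elim/quotW=> x; rewrite -!pi_lmod_scale scale1r. Qed.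

Fact lmod_quot_scaleDr : right_distributive lmod_quot_scale +%R.
Proof.
move=> a u v; elim/quotW: u => x; elim/quotW: v => y.
by rewrite -!(pi_lmod_scale, pi_lmod_add) scalerDr.
Qed.

Fact lmod_quot_scaleDl v : {morph lmod_quot_scale^~ v : a b / a + b}.
Proof.
move=> a b; elim/quotW: v => x.
by rewrite -!(pi_lmod_scale, pi_lmod_add) scalerDl.
Qed.

HB.instance Definition _ := GRing.Zmodule_isLmodule.Build K lmod_quot
  lmod_quot_scaleA lmod_quot_scale1 lmod_quot_scaleDr lmod_quot_scaleDl.

End LmodQuotient.

Section Category.
Variables (K : fieldType) (N : nat).

(* The object T_j is the ordinal j : 'I_N.+1. *)
Implicit Types i j k l x y z u v : 'I_N.+1.

Definition ndist (m n : nat) : nat := `|m%:Z - n%:Z|%N.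

Definition delta (i j k : nat) : nat := (ndist i j + ndist j k - ndist i k)./2.

(* Hom(T_x, T_y): the polynomial \sum_n c_n 'X^n stands for
   \sum_n c_n a_{yx} s^n. *)
Definition mor (x y : 'I_N.+1) : Type := {poly K}.
HB.instance Definition _ x y := GRing.Lmodule.on (mor x y).

(* a_{yx} s^n *)
Definition bas (y x : 'I_N.+1) (n : nat) : mor x y := ('X^n : {poly K}).

(* The bilinear extension of
   a_{zy} s^m . a_{yx} s^n = a_{zx} s^(m + n + delta x y z). *)
Definition mor_comp x y z (b : mor y z) (a : mor x y) : mor x z :=
  ('X^(delta x y z) * (b * a) : {poly K}).

(* Bounded complexes over the category: summand r is T_(ob r) placed in degree
   dg r, and dif r c : T_(ob c) -> T_(ob r). *)
Record tw : Type := Tw {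
  rk : nat;
  ob : 'I_rk -> 'I_N.+1;
  dg : 'I_rk -> int;
  dif : 'M[{poly K}]_rk;
  dif_deg : forall r c, dg r - dg c != 1 -> dif r c = 0;
  dif_sq : forall r c,
    \sum_m @mor_comp (ob c) (ob m) (ob r) (dif r m) (dif m c) = 0
}.

(* The entry f r c is a morphism T_(ob X c) -> T_(ob Y r). *)
Definition twmor (X Y : tw) : Type := 'M[{poly K}]_(rk Y, rk X).
HB.instance Definition _ X Y := GRing.Lmodule.on (twmor X Y).

Definition tw_homog (e : int) (X Y : tw) (f : twmor X Y) : Prop :=
  forall r c, dg r - dg c != e -> f r c = 0.

Definition twcomp X Y Z (g : twmor Y Z) (f : twmor X Y) : twmor X Z :=
  \matrix_(r, c) \sum_m @mor_comp (ob c) (ob m) (ob r) (g r m) (f m c).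

Definition twsign (e : int) : {poly K} := (-1) ^ e.

(* mu^1_delta on an element of degree e. *)
Definition tw_mu1 (e : int) X Y (f : twmor X Y) : twmor X Y :=
  twsign e *: @twcomp X Y Y (dif Y) f - @twcomp X X Y f (dif X).

(* mu^2_delta(g, f) for f of degree e. *)
Definition tw_mu2 (e : int) X Y Z (g : twmor Y Z) (f : twmor X Y) : twmor X Z :=
  twsign e *: twcomp g f.

Program Definition single x : tw :=
  @Tw 1 (fun=> x) (fun=> 0) 0 _ _.
Next Obligation. by rewrite mxE. Qed.
Next Obligation. by rewrite big1 // => m _; rewrite /mor_comp !mxE mulr0 mulr0. Qed.

Definition single_mor x y (a : mor x y) : twmor (single x) (single y) :=
  const_mx (a : {poly K}).

(* Composable strings T_{X_0} -> ... -> T_{X_d}; the head of the string is the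
   first map a_1 : X_0 -> X_1. *)
Inductive chain : 'I_N.+1 -> 'I_N.+1 -> Type :=
| nilc x : chain x x
| consc x y z (a : mor x y) (c : chain y z) : chain x z.

Fixpoint chain_size x y (c : chain x y) : nat :=
  match c with nilc _ => 0 | consc _ _ _ _ c' => (chain_size c').+1 end.

Fixpoint chain_cat x y z (c1 : chain x y) : chain y z -> chain x z :=
  match c1 in chain x y return chain y z -> chain x z with
  | nilc _ => fun c2 => c2
  | consc _ _ _ a c' => fun c2 => consc a (chain_cat c' c2)
  end.

(* X_m *)
Fixpoint chain_obj x y (c : chain x y) (m : nat) : 'I_N.+1 :=
  match c with
  | nilc x0 => x0
  | consc x0 _ _ _ c' => if m is m'.+1 then chain_obj c' m' else x0
  end.

(* (a_m, ..., a_1) *)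
Fixpoint chain_take x y (c : chain x y) (m : nat) : chain x (chain_obj c m) :=
  match c as c0 in chain x0 _ return chain x0 (chain_obj c0 m) with
  | nilc x0 => nilc x0
  | consc x0 _ _ a c' =>
    match m return chain x0 (chain_obj (consc a c') m) with
    | 0 => nilc x0
    | m'.+1 => consc a (chain_take c' m')
    end
  end.

(* (a_d, ..., a_{m+1}) *)
Fixpoint chain_drop x y (c : chain x y) (m : nat) : chain (chain_obj c m) y :=
  match c as c0 in chain _ y0 return chain (chain_obj c0 m) y0 with
  | nilc x0 => nilc x0
  | consc _ _ y0 a c' =>
    match m return chain (chain_obj (consc a c') m) y0 with
    | 0 => consc a c'
    | m'.+1 => chain_drop c' m'
    end
  end.

(* (a_d, ..., a_{n+2} . a_{n+1}, ..., a_1) *)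
Fixpoint chain_merge x y (c : chain x y) (n : nat) : chain x y :=
  match c in chain x y return chain x y with
  | nilc x0 => nilc x0
  | consc x0 x1 y0 a c' =>
    match n with
    | 0 =>
      match c' in chain x1 y0 return mor x0 x1 -> chain x0 y0 with
      | nilc _ => fun a1 => consc a1 (nilc _)
      | consc _ _ _ a2 c'' => fun a1 => consc (mor_comp a2 a1) c''
      end a
    | n'.+1 => consc a (chain_merge c' n')
    end
  end.

(* The objects and components of an A_oo-functor to Tw^b, without the functor
   equations, on which the definition of mu1 does not depend; the value of
   functor_comp on strings of length 0 is never used. *)
Record functor_data : Type := FunctorData {
  functor_obj :> 'I_N.+1 -> tw;
  functor_comp : forall x y, chain x y -> twmor (functor_obj x) (functor_obj y)
}.

Section NaturalTransformations.
Variable B : functor_data.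

(* Families (eta^d)_{d >= 0}; eta^d is the restriction to strings of
   length d. *)
Definition cochain : Type := forall x y, chain x y -> twmor (single x) (B y).

Lemma cochainP (f g : cochain) : (forall x y (c : chain x y), f x y c = g x y c) -> f = g.
Proof.
by move=> fg; apply: functional_extensionality_dep => x;
   apply: functional_extensionality_dep => y; apply: funext => c.
Qed.

HB.instance Definition _ := gen_eqMixin cochain.
HB.instance Definition _ := gen_choiceMixin cochain.

Definition cochain0 : cochain := fun x y c => 0.
Definition cochain_opp (f : cochain) : cochain := fun x y c => - f x y c.
Definition cochain_add (f g : cochain) : cochain := fun x y c => f x y c + g x y c.
Definition cochain_scale (t : K) (f : cochain) : cochain :=
  fun x y c => t%:P *: f x y c.

Fact cochain_addA : associative cochain_add.
Proof. by move=> f g h; apply: cochainP => x y c; exact: addrA. Qed.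
Fact cochain_addC : commutative cochain_add.
Proof. by move=> f g; apply: cochainP => x y c; exact: addrC. Qed.
Fact cochain_add0 : left_id cochain0 cochain_add.
Proof. by move=> f; apply: cochainP => x y c; exact: add0r. Qed.
Fact cochain_addN : left_inverse cochain0 cochain_opp cochain_add.
Proof. by move=> f; apply: cochainP => x y c; exact: addNr. Qed.

HB.instance Definition _ :=
  GRing.isZmodule.Build cochain cochain_addA cochain_addC cochain_add0 cochain_addN.

Fact cochain_scaleA s t f : cochain_scale s (cochain_scale t f) = cochain_scale (s * t) f.
Proof. by apply: cochainP => x y c; rewrite /cochain_scale scalerA polyCM. Qed.
Fact cochain_scale1 : left_id 1 cochain_scale.
Proof. by move=> f; apply: cochainP => x y c; exact: scale1r. Qed.
Fact cochain_scaleDr : right_distributive cochain_scale +%R.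
Proof. by move=> t f g; apply: cochainP => x y c; exact: scalerDr. Qed.
Fact cochain_scaleDl f : {morph cochain_scale^~ f : s t / s + t}.
Proof.
by move=> s t; apply: cochainP => x y c; rewrite /cochain_scale polyCD; exact: scalerDl.
Qed.

HB.instance Definition _ := GRing.Zmodule_isLmodule.Build K cochain
  cochain_scaleA cochain_scale1 cochain_scaleDr cochain_scaleDl.

(* Degree g pre-natural transformations id => B. *)
Definition is_prenat (g : int) (f : cochain) : Prop :=
  (forall x u v y (c1 : chain x u) (c2 : chain v y) (t : K) (a b : mor u v),
     f x y (chain_cat c1 (consc (t *: a + b) c2)) =
     t%:P *: f x y (chain_cat c1 (consc a c2)) + f x y (chain_cat c1 (consc b c2)))
  /\ (forall x y (c : chain x y), tw_homog (g - (chain_size c)%:Z) (f x y c)).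

(* eta^{d-1}(a_d, ..., a_2), a_1 *)
Definition mu1_last (f : cochain) x y (c : chain x y) : twmor (single x) (B y) :=
  match c in chain x y return twmor (single x) (B y) with
  | nilc _ => 0
  | consc _ _ _ a c' => tw_mu2 0 (f _ _ c') (single_mor a)
  end.

(* The differential of a degree g pre-natural transformation. *)
Definition mu1 (g : int) (f : cochain) : cochain := fun x y c =>
  let d := chain_size c in
  tw_mu1 (g - d%:Z) (f x y c)
  + \sum_(m < d) tw_mu2 (g - m%:Z) (functor_comp B (chain_drop c m))
                        (f _ _ (chain_take c m))
  + twsign (g - 1) *: mu1_last f c
  - \sum_(n < d.-1) twsign (n%:Z + g - 1) *: f x y (chain_merge c n).

Lemma comp_linear_l x y z (a : mor x y) t (b b' : mor y z) :
  @mor_comp x y z (t%:P * b + b' : {poly K}) a = t%:P * mor_comp b a + mor_comp b' a :> {poly K}.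
Proof. by rewrite /mor_comp mulrDl mulrDr -!mulrA; congr (_ + _); rewrite mulrCA. Qed.

Lemma comp_linear_r x y z (b : mor y z) t (a a' : mor x y) :
  @mor_comp x y z b (t%:P * a + a' : {poly K}) = t%:P * mor_comp b a + mor_comp b a' :> {poly K}.
Proof.
rewrite /mor_comp mulrDr mulrDr; congr (_ + _).
by rewrite [b * _]mulrCA [LHS]mulrCA.
Qed.

Lemma twcomp_linear_l X Y Z (f : twmor X Y) t (g g' : twmor Y Z) :
  twcomp (t%:P *: g + g') f = t%:P *: twcomp g f + twcomp g' f.
Proof.
apply/matrixP=> r c; rewrite !mxE mulr_sumr -big_split /=.
by apply: eq_bigr => m _; rewrite !mxE comp_linear_l.
Qed.

Lemma twcomp_linear_r X Y Z (g : twmor Y Z) t (f f' : twmor X Y) :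
  twcomp g (t%:P *: f + f') = t%:P *: twcomp g f + twcomp g f'.
Proof.
apply/matrixP=> r c; rewrite !mxE mulr_sumr -big_split /=.
by apply: eq_bigr => m _; rewrite !mxE comp_linear_r.
Qed.

Lemma scale_swap (X Y : tw) (s t : {poly K}) (f f' : twmor X Y) :
  s *: (t *: f + f') = t *: (s *: f) + s *: f'.
Proof. by rewrite scalerDr !scalerA mulrC. Qed.

Lemma mu1_is_linear g : linear (mu1 g).
Proof.
move=> t f f'; apply: cochainP => x y c.
set d := chain_size c.
change (mu1 g (t *: f + f') c = t%:P *: mu1 g f c + mu1 g f' c).

rewrite /mu1 -/d.
have E1 : tw_mu1 (g - d%:Z) ((t *: f + f') x y c) =
    t%:P *: tw_mu1 (g - d%:Z) (f x y c) + tw_mu1 (g - d%:Z) (f' x y c).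
  rewrite /tw_mu1 twcomp_linear_r twcomp_linear_l [in LHS]scale_swap.
  by rewrite scalerBr opprD addrACA.
have E2 : \sum_(m < d) tw_mu2 (g - m%:Z) (functor_comp B (chain_drop c m))
                        ((t *: f + f') _ _ (chain_take c m)) =
   t%:P *: \sum_(m < d) tw_mu2 (g - m%:Z) (functor_comp B (chain_drop c m))
                        (f _ _ (chain_take c m)) +
   \sum_(m < d) tw_mu2 (g - m%:Z) (functor_comp B (chain_drop c m))
                        (f' _ _ (chain_take c m)).
  rewrite scaler_sumr -big_split; apply: eq_bigr => m _.
  by rewrite /tw_mu2 twcomp_linear_r scale_swap.
have E3 : mu1_last (t *: f + f') c = t%:P *: mu1_last f c + mu1_last f' c.
  case: (x) (y) / c {d E1 E2} => [x0|x0 x1 y0 a c] /=; first by rewrite scaler0 addr0.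
  by rewrite /tw_mu2 twcomp_linear_l scale_swap.
have E4 : \sum_(n < d.-1) twsign (n%:Z + g - 1) *: (t *: f + f') x y (chain_merge c n) =
   t%:P *: \sum_(n < d.-1) twsign (n%:Z + g - 1) *: f x y (chain_merge c n) +
   \sum_(n < d.-1) twsign (n%:Z + g - 1) *: f' x y (chain_merge c n).
  rewrite scaler_sumr -big_split; apply: eq_bigr => n _.
  exact: scale_swap.
rewrite E1 E2 E3 E4 [twsign (g - 1) *: (_ + _)]scale_swap opprD -scalerN.
by do 3![rewrite (addrACA (t%:P *: _) _ (t%:P *: _)) -scalerDr].
Qed.

HB.instance Definition _ g :=
  GRing.isLinear.Build K cochain cochain _ (mu1 g) (mu1_is_linear g).

Lemma prenat_submod g : submod_closed (fun f => `[< is_prenat g f >]).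
Proof.
split=> [|t f f' /asboolP[fL fD] /asboolP[f'L f'D]].
  apply/asboolP; split=> [*|x y c r s _]; last by rewrite mxE.
  by rewrite /= scaler0 addr0.
apply/asboolP; split=> [x u v y c1 c2 s a b|x y c r e rs].
  change (t%:P *: f x y (chain_cat c1 (consc (s *: a + b) c2)) +
          f' x y (chain_cat c1 (consc (s *: a + b) c2)) =
          s%:P *: (t%:P *: f x y (chain_cat c1 (consc a c2)) +
                   f' x y (chain_cat c1 (consc a c2))) +
          (t%:P *: f x y (chain_cat c1 (consc b c2)) +
           f' x y (chain_cat c1 (consc b c2)))).
  by rewrite fL f'L [in LHS]scale_swap [in RHS]scalerDr addrACA.
change ((t%:P *: f x y c + f' x y c) r e = 0).
by rewrite !mxE fD // f'D // mulr0 addr0.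
Qed.

(* mu^1(eta) = 0 *)
Definition is_nat_trans (g : int) (f : cochain) : Prop :=
  is_prenat g f /\ mu1 g f = 0.

Definition nat_trans_pred (g : int) : {pred cochain} := fun f => `[< is_nat_trans g f >].

Lemma nat_trans_submod g : submod_closed (nat_trans_pred g).
Proof.
have [P0 PD] := prenat_submod g; split=> [|t f f' /asboolP[fP f0] /asboolP[f'P f'0]].
  by apply/asboolP; split; [exact/asboolP | exact: linear0].
apply/asboolP; split; last by rewrite mu1_is_linear f0 f'0 scaler0 addr0.
by apply/asboolP; apply: PD; exact/asboolP.
Qed.

HB.instance Definition _ g :=
  GRing.isSubmodClosed.Build K cochain (nat_trans_pred g) (nat_trans_submod g).

(* The K-module of degree g A_oo-natural transformations id => B. *)
Record nat_trans (g : int) : Type := NatTrans {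
  nat_trans_val :> cochain;
  nat_trans_valP : nat_trans_val \in nat_trans_pred g
}.

HB.instance Definition _ g := [isSub for @nat_trans_val g].
HB.instance Definition _ g := [Choice of nat_trans g by <:].
HB.instance Definition _ g := [SubChoice_isSubLmodule of nat_trans g by <:].

Definition mk_nat_trans g (f : cochain) (fP : is_nat_trans g f) : nat_trans g :=
  @NatTrans g f (asboolT fP).

Definition is_coboundary (g : int) (f : nat_trans g) : Prop :=
  exists2 h : cochain, is_prenat (g - 1) h & (f : cochain) = mu1 (g - 1) h.

Definition coboundary (g : int) : {pred nat_trans g} := fun f => `[< is_coboundary f >].

Lemma coboundary_submod g : submod_closed (@coboundary g).
Proof.
have [P0 PD] := prenat_submod (g - 1).
split=> [|t f f' /asboolP[h hP fh] /asboolP[h' h'P fh']].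
  by apply/asboolP; exists 0; [exact/asboolP | rewrite linear0].
apply/asboolP; exists (t *: h + h'); last by rewrite mu1_is_linear -fh -fh'.
by apply/asboolP; apply: PD; exact/asboolP.
Qed.

(* HH^g = H^g Hom(id, B): cocycles modulo those cocycles that are mu^1 of a
   pre-natural transformation of degree g - 1 (when B satisfies the A_oo-functor
   equations, every such mu^1 is a cocycle). *)
Definition HH (g : int) : lmodType K := lmod_quot (coboundary_submod g).

Definition HH_class g (f : nat_trans g) : HH g := \pi_(lmod_quot (coboundary_submod g)) f.

End NaturalTransformations.

Section Braiding.
Variable i : 'I_N.+1.

Let lft : 'I_N.+1 := inord i.-1.
Let rgt : 'I_N.+1 := inord i.+1.

(* Summand 0 is T_i in degree -1; summands 1 and 2 are T_{i-1} and T_{i+1} in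
   degree 0. *)
Definition cone_ob (r : 'I_3) : 'I_N.+1 := nth i [:: i; lft; rgt] r.
Definition cone_dg (r : 'I_3) : int := if val r == 0%N then -1 else 0.
Definition cone_dif : 'M[{poly K}]_3 := \matrix_(r, c)
  if val c != 0%N then 0
  else nth 0 [:: 0; bas lft i 0; - bas rgt i 0 ] r.

Fact cone_dif_deg r c : cone_dg r - cone_dg c != 1 -> cone_dif r c = 0.
Proof.
move=> rc; rewrite mxE; case: ifPn => // /negPn/eqP c0.
by move: rc; rewrite /cone_dg c0; case: r => [[|[|[|r]]] hr].
Qed.

Fact cone_dif_sq r c :
  \sum_m @mor_comp (cone_ob c) (cone_ob m) (cone_ob r) (cone_dif r m) (cone_dif m c) = 0.
Proof.
rewrite big1 // => m _; rewrite /mor_comp !mxE.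
case: (eqVneq (val m) 0%N) => [->|_] /=; last by rewrite mul0r mulr0.
by case: ifP => _; rewrite mulr0 mulr0.
Qed.

Definition cone : tw := Tw cone_dif_deg cone_dif_sq.

Definition braid_obj j : tw := if j == i then cone else single j.

(* The summand of braid_obj i that is T_{i + sgn(j - i)}, for j != i. *)
Definition side (j : 'I_N.+1) : nat := if (i < j)%N then 2 else 1.

(* Entry (r, c) of beta^1(a) for a : T_j -> T_k, the summands of braid_obj j
   and braid_obj k being numbered as above. *)
Definition beta1_entry j k (a : mor j k) (r c : nat) : {poly K} :=
  if k != i then
    if j != i then a
    else if c == 0%N then 0
    else if c == side k then 'X * a else a
  else if j != i then
    if r == side j then a else 0
  else if r == c then a else 0.

Definition beta1 j k (a : mor j k) : twmor (braid_obj j) (braid_obj k) :=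
  \matrix_(r, c) beta1_entry a r c.

Definition beta2_coef k (b a : {poly K}) : {poly K} :=
  (sgz (i%:Z - k%:Z))%:~R *: ('X^((ndist i k).-1) * (b * a)).

(* Entry (r, c) of beta^2(b, a) for a : T_j -> T_k and b : T_k -> T_l. *)
Definition beta2_entry j k l (b : mor k l) (a : mor j k) (r c : nat) : {poly K} :=
  if (l != i) || (r != 0%N) then 0
  else if j != i then
    if (i%:Z - j%:Z) * (i%:Z - k%:Z) < 0 then beta2_coef k b a else 0
  else
    if (k != i) && (c == (if (k < i)%N then 2 else 1)%N) then beta2_coef k b a
    else 0.

Definition beta2 j k l (b : mor k l) (a : mor j k) :
    twmor (braid_obj j) (braid_obj l) :=
  \matrix_(r, c) beta2_entry b a r c.

(* The family with values f1 and f2 on strings of length 1 and 2, and zero on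
   all other strings. *)
Definition on_chain2 (F : 'I_N.+1 -> 'I_N.+1 -> Type) (zero : forall x y, F x y)
    (f1 : forall x y, mor x y -> F x y)
    (f2 : forall x y z, mor y z -> mor x y -> F x z) x y (c : chain x y) : F x y :=
  match c in chain x y return F x y with
  | nilc x0 => zero x0 x0
  | consc x0 x1 y0 a1 c' =>
    match c' in chain x1 y0 return mor x0 x1 -> F x0 y0 with
    | nilc _ => fun a1 => f1 _ _ a1
    | consc _ x2 y1 a2 c'' =>
      match c'' in chain x2 y1 return mor _ x2 -> mor x0 _ -> F x0 y1 with
      | nilc _ => fun a2 a1 => f2 _ _ _ a2 a1
      | consc _ _ _ _ _ => fun _ _ => zero _ _
      end a2
    end a1
  end.

Definition braid : functor_data := @FunctorData braid_obj
  (@on_chain2 (fun x y => twmor (braid_obj x) (braid_obj y)) (fun _ _ => 0) beta1 beta2).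

(* A finitely supported sequence (sigma_l) is the polynomial with these
   coefficients. *)
Variable sigma : {poly K}.

Definition qcoef (j k : nat) (n : nat) : K := (2 * n + ndist j k)%:R.

(* Q(a_{ik} s^m, a_{kj} s^n), the composite being a_{ij} s^(m + n + delta j k i). *)
Definition Qcoef (j k : 'I_N.+1) (m n : nat) : K :=
  let qc := qcoef j i (m + n + delta j k i) in
  if ((k < i) && (i < j) || (j < i) && (i < k))%N then (sgz (i%:Z - k%:Z))%:~R * qc
  else if k == i then (sgz (j%:Z - i%:Z))%:~R * (2^-1 * qcoef k i m)
  else if j == i then (sgz (i%:Z - k%:Z))%:~R * (2^-1 * qc)
  else 0.

(* Row r of eta^1(a_{kj} s^n); the truncated n + l - 1 only differs from the
   integer one where qcoef (resp. Qcoef below) vanishes. *)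
Definition eta1_basis (j k : 'I_N.+1) (r n : nat) : {poly K} :=
  qcoef j k n *: \sum_(l < size sigma) (2^-1 * sigma`_l) *:
    (if k != i then bas k j (n + l)
     else if j != i then
       if r == side j then bas (if (i < j)%N then rgt else lft) j (n + l) else 0
     else if r == 0%N then 0
     else 2^-1 *: bas (if r == 1%N then lft else rgt) i (n + l).-1).

(* Row r of eta^2(a_{lk} s^m, a_{kj} s^n), with the same truncation. *)
Definition eta2_basis (j k l : 'I_N.+1) (r m n : nat) : {poly K} :=
  if (l != i) || (r != 0%N) then 0
  else Qcoef j k m n *: \sum_(e < size sigma) (2^-1 * sigma`_e) *:
         (bas i j (m + n + delta j k i + e).-1 : {poly K}).

(* The (bi)linear extensions. *)
Definition eta1 j k (a : mor j k) : twmor (single j) (braid_obj k) :=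
  \matrix_(r, c) \sum_(n < size (a : {poly K})) (a : {poly K})`_n *: eta1_basis j k r n.

Definition eta2 j k l (b : mor k l) (a : mor j k) : twmor (single j) (braid_obj l) :=
  \matrix_(r, c)
    \sum_(m < size (b : {poly K})) \sum_(n < size (a : {poly K}))
      ((b : {poly K})`_m * (a : {poly K})`_n) *: eta2_basis j k l r m n.

Definition eta_nat : cochain braid :=
  @on_chain2 (fun x y => twmor (single x) (braid_obj y)) (fun _ _ => 0) eta1 eta2.

End Braiding.

End Category.

Arguments braid K {N} i.
Arguments eta_nat {K N} i sigma [x y] c.
Arguments mu1 {K N B} g f [x y] c.

(* Main.v *)
Require Import Defs.
From HB Require Import structures.
From mathcomp Require Import all_boot all_order all_algebra.
From mathcomp Require Import boolp zify ring.

Set Implicit Arguments.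
Unset Strict Implicit.
Unset Printing Implicit Defensive.

Import Order.TTheory GRing.Theory Num.Theory.
Local Open Scope ring_scope.

(** The category embeds in the polynomial ring K[X]: it is the full subcategory of
    graded modules over K[u, v] on the twists of the free module of rank one, with
    [s = u v], [p = u] and [q = v], and setting [v = 1] and [u = 'X] makes every
    map a polynomial and every composition a product ([emb_comp],
    [emb_col_comp]). The complex replacing [T_i] is then a truncated Koszul complex
    of (u, v). It is exact except at its end, where the augmentation by the row
    (u, v) identifies its cohomology with the ideal (u, v) inside [T_i]. The
    augmentation is compatible with the braiding functor ([aug_beta1]), whose
    bimodule is therefore, up to homotopy, that of the identity functor with the
    identity of [T_i] removed.

    Complexes in degrees -1 and 0 leave only two components to a cochain of degree
    1, on strings of length 1 and 2. The differential of the cone is injective, so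
    the second component is determined by the first one, and the cocycle equation
    on strings of length 3 follows from the one on strings of length 2 and from the
    A-infinity equation of the functor ([beta_comp], [nat_transP],
    [cocycle_eq_coboundary]). Augmenting the first component of a cocycle gives a
    derivation of the category ([aug_of_leibniz]), and coboundaries give the
    commutators with families of scalars ([aug_mu1], [inner_coboundary]). The
    cohomology in degree 1 is thus the space of derivations modulo inner ones.

    The formulas for [eta] are a lift of half of [sigma] times the Euler derivation
    through the augmentation: the value on a map into [T_i] is put on the summand
    on the side of the source, and is divided equally between the two summands for
    endomorphisms of [T_i]. The second component records how these choices fail to
    be compatible with composition ([eta1_aug], [eta2_top], [eta_nat_trans]).

    A derivation is determined by its values on [s_i] and on the generators
    [a_{ji}] out of [T_i] ([derivation_eq0]). The values on the generators can be
    adjusted by a commutator, whereas the value on [s_i] is a multiple [s_i sigma]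
    that no commutator changes. This [sigma] is the parameter of the cohomology
    class ([eta_inj], [eta_surj]). *)

(** * The category inside the polynomial ring *)
Section Embedding.
Variables (K : fieldType) (N : nat).
Implicit Types (j k l x y z : 'I_N.+1).

(** The factor by which [a_{yx}] is represented when the category is embedded in
    the polynomial ring: in the graded ring K[u, v], with [s = u v], the map
    [a_{yx}] is [u ^ (y - x)] or [v ^ (x - y)], and one sets [v = 1]. The
    subtraction is the truncated one. *)
Definition weight (x y : nat) : {poly K} := 'X^(y - x).

Lemma weight_neq0 x y : weight x y != 0.
Proof. by rewrite monic_neq0 ?monicXn. Qed.

Lemma weight_pred (j k : nat) : (j < k)%N -> 'X * weight j k.-1 = weight j k.
Proof. by move=> jk; rewrite /weight -exprS; congr (_ ^+ _); lia. Qed.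

Lemma weight_succ (j k : nat) : (j <= k)%N -> 'X * weight j k = weight j k.+1.
Proof. by move=> jk; rewrite /weight subSn // exprS. Qed.

Definition emb x y (a : mor K x y) : {poly K} := weight x y * (a : {poly K}).

(** The correction exponent [delta] is exactly what makes the embedding
    multiplicative, hence composition associative. *)
Lemma weight_delta (x y z : nat) : weight x z * 'X^(delta x y z) = weight y z * weight x y.
Proof. by rewrite /weight -!exprD /delta /ndist; congr (_ ^+ _); lia. Qed.

Lemma emb_comp x y z (b : mor K y z) (a : mor K x y) :
  emb (mor_comp b a) = emb b * emb a.
Proof. by rewrite /emb /mor_comp mulrA weight_delta mulrACA. Qed.

Lemma emb_inj x y : injective (@emb x y).
Proof. exact: (mulfI (weight_neq0 x y)). Qed.

Lemma emb_linear x y t (a b : mor K x y) : emb (t *: a + b) = t *: emb a + emb b.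
Proof. by rewrite /emb mulrDr -scalerAr. Qed.

Lemma mor_compA w x y z (c : mor K y z) (b : mor K x y) (a : mor K w x) :
  mor_comp (mor_comp c b) a = mor_comp c (mor_comp b a).
Proof. by apply: emb_inj; rewrite !emb_comp mulrA. Qed.

Lemma single_mor_linear j k t (a b : mor K j k) :
  single_mor (t *: a + b) = t%:P *: single_mor a + single_mor b.
Proof. by apply/matrixP => r c; rewrite !mxE -mul_polyC. Qed.

(** Applying the embedding entrywise turns composition in the category of
    complexes into the product of matrices. *)
Definition emb_mx (X Y : tw K N) (f : twmor X Y) : 'M[{poly K}]_(rk Y, rk X) :=
  \matrix_(r, c) (weight (ob c) (ob r) * f r c).

(** The case of a one-term source, stated for columns so that the dimension is
    syntactically 1. *)
Definition emb_col x (Y : tw K N) (f : twmor (single K x) Y) : 'cV[{poly K}]_(rk Y) :=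
  \col_r (weight x (ob r) * f r ord0).

Lemma emb_col_comp x Y Z (g : twmor Y Z) (f : twmor (single K x) Y) :
  emb_col (twcomp g f) = emb_mx g *m emb_col f.
Proof.
apply/matrixP => r c; rewrite !mxE mulr_sumr; apply: eq_bigr => m _.
by rewrite !mxE /mor_comp mulrA weight_delta mulrACA.
Qed.

Lemma emb_col_single x y Z (f : twmor (single K y) Z) (a : mor K x y) :
  emb_col (twcomp f (single_mor a)) = emb a *: emb_col f.
Proof.
apply/matrixP => r c; rewrite !mxE big_ord1 !mxE /mor_comp mulrA weight_delta /emb.
by rewrite mulrACA mulrC.
Qed.

Lemma emb_col_inj x Y : injective (@emb_col x Y).
Proof.
move=> f g /matrixP fg; apply/matrixP => r c; rewrite (ord1 c).
by have:= fg r ord0; rewrite !mxE => /(mulfI (weight_neq0 _ _)).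
Qed.

Lemma emb_mx0 (X Y : tw K N) : emb_mx (0 : twmor X Y) = 0.
Proof. by apply/matrixP => r c; rewrite !mxE mulr0. Qed.

Lemma emb_col0 x Y : emb_col (0 : twmor (single K x) Y) = 0.
Proof. by apply/matrixP => r c; rewrite !mxE mulr0. Qed.

Lemma emb_colD x Y (f g : twmor (single K x) Y) : emb_col (f + g) = emb_col f + emb_col g.
Proof. by apply/matrixP => r c; rewrite !mxE mulrDr. Qed.

Lemma emb_colN x Y (f : twmor (single K x) Y) : emb_col (- f) = - emb_col f.
Proof. by apply/matrixP => r c; rewrite !mxE mulrN. Qed.

Lemma emb_colZ x Y t (f : twmor (single K x) Y) : emb_col (t *: f) = t *: emb_col f.
Proof. by apply/matrixP => r c; rewrite !mxE mulrCA. Qed.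

Lemma polyX_neq0 : 'X != 0 :> {poly K}.
Proof. by rewrite polyX_eq0. Qed.

Lemma scaleX_inj m n : injective (fun A : 'M[{poly K}]_(m, n) => 'X *: A).
Proof.
move=> A A' /matrixP E; apply/matrixP => r c; have:= E r c; rewrite !mxE.
by apply: mulfI; rewrite polyX_eq0.
Qed.

End Embedding.

(** * The braided complexes over the polynomial ring *)
Section Braid.
Variables (K : fieldType) (N : nat) (i : 'I_N.+1).
Implicit Types (j k l x y z : 'I_N.+1).

Notation B := (braid_obj K i).

Lemma rk_braid k : rk (B k) = if k == i then 3 else 1.
Proof. by rewrite /braid_obj; case: ifP. Qed.

Lemma sum_braid k (F : nat -> {poly K}) :
  \sum_(m < rk (B k)) F m = if k == i then F 0 + F 1 + F 2 else F 0.
Proof.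
rewrite rk_braid; case: ifP => _; last by rewrite big_ord1.
by rewrite !big_ord_recr big_ord0 /= add0r.
Qed.

Lemma lt_braid k (r : 'I_(rk (B k))) : (r < if k == i then 3 else 1)%N.
Proof. by rewrite -rk_braid. Qed.

Lemma ob_braid k (r : 'I_(rk (B k))) :
  ob r = (if k == i then nth i [:: i; inord i.-1; inord i.+1] r else k) :> 'I_N.+1.
Proof. by move: r; rewrite /braid_obj; case: ifP. Qed.

Lemma dg_braid k (r : 'I_(rk (B k))) :
  dg r = if (k == i) && (r == 0%N :> nat) then -1 else 0.
Proof. by move: r; rewrite /braid_obj; case: ifP. Qed.

Hypotheses (i_gt0 : (0 < i)%N) (i_ltN : (i < N)%N).

(** Here the position [i] must be interior, for both neighbours of [T_i] to
    exist. *)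
Lemma ob_braid_nat k (r : 'I_(rk (B k))) :
  ob r = (if k == i then nth (i : nat) [:: (i : nat); i.-1; i.+1] r else k) :> nat.
Proof.
rewrite ob_braid; have:= lt_braid r; case: ifP => // _.
by case: r => -[|[|[|]]] //= _ _; rewrite inordK //; lia.
Qed.

(** How [beta^1] and [eta^1] split a map from [T_k] to [T_i] between the
    summands [T_{i-1}] and [T_{i+1}]: [lam k] is the share of the former. For
    [k = i] this is the symmetric choice made by [eta]. *)
Definition lam k : {poly K} :=
  if (k < i)%N then 1 else if k == i then (2^-1)%:P else 0.

Lemma ord_eqE (j k : 'I_N.+1) : (j == k) = (j == k :> nat).
Proof. by []. Qed.

Lemma lam_lt k : (k < i)%N -> lam k = 1.
Proof. by rewrite /lam => ->. Qed.

Lemma lam_gt k : (i < k)%N -> lam k = 0.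
Proof. by move=> ki; rewrite /lam ltnNge (ltnW ki) /= ord_eqE gtn_eqF. Qed.

Lemma lam_i : lam i = (2^-1)%:P.
Proof. by rewrite /lam ltnn eqxx. Qed.

(** The augmentation of the complex at [i] to [T_i]: the row of the maps
    [p_i = u] and [q_i = v] after the embedding. It identifies the complex up to
    homotopy with the ideal (u, v) shifted as [T_i]. *)
Definition aug_entry k (r : nat) : {poly K} :=
  if k == i then [:: 0; 'X; 1]`_r else 1.

Definition aug k : 'rV[{poly K}]_(rk (B k)) := \row_r aug_entry k r.

(** Since ['X] becomes invertible after localisation, [beta^1] of a map is the
    map times a constant matrix divided by ['X]; this is that constant matrix. *)
Definition beta1_mx_entry k l (r c : nat) : {poly K} :=
  if l != i then 'X * aug_entry k c
  else if k != i then [:: 0; lam k; 'X * (1 - lam k)]`_r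
  else 'X * (r == c)%:R.

Definition beta1_mx k l : 'M[{poly K}]_(rk (B l), rk (B k)) :=
  \matrix_(r, c) beta1_mx_entry k l r c.

Lemma emb_mx_beta1 k l (b : mor K k l) : 'X *: emb_mx (beta1 i b) = emb b *: beta1_mx k l.
Proof.
apply/matrixP => r c; rewrite !mxE /beta1_mx_entry /beta1_entry /aug_entry /emb /weight.
rewrite !ob_braid_nat.
have:= lt_braid r; have:= lt_braid c.
case: (nat_of_ord r) => [|[|[|?]]]; case: (nat_of_ord c) => [|[|[|?]]];
 case: ifP => //= ki; case: ifP => //= li _ _ ; rewrite /side /lam ?(eqP ki) ?(eqP li) ?ltnn ?eqxx.
all: try ring.
all: move: ki li; rewrite !ord_eqE.
all: move=> ki li; try have := i_gt0.
all: try case: (ltngtP i k) ki => //= ki _; try case: (ltngtP i l) li => //= li _.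
all: move=> _; rewrite ?subnn ?(mulr0, mul0r) // ?subrr ?(mulr0, mul0r) //.
all: rewrite [RHS]mulrAC ?subr0 ?mulr1 !mulrA -?exprS -?exprSr.
all: by congr (_ * _); congr (_ ^+ _); lia.
Qed.

(** The constant matrix of [beta^2], which is again to be divided by ['X]. *)
Definition beta2_mx_entry j k l (r c : nat) : {poly K} :=
  if (l != i) || (k == i) || (r != 0%N) then 0
  else if j != i then lam k - lam j
  else [:: 0; (lam k - 1) * 'X; lam k]`_c.

Definition beta2_mx j k l : 'M[{poly K}]_(rk (B l), rk (B j)) :=
  \matrix_(r, c) beta2_mx_entry j k l r c.

Lemma emb_mx_beta2 j k l (b : mor K k l) (a : mor K j k) :
  'X *: emb_mx (beta2 i b a) = (emb b * emb a) *: beta2_mx j k l.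
Proof.
apply/matrixP => r c; rewrite !mxE /beta2_mx_entry /beta2_entry /emb /weight /beta2_coef.
rewrite !ob_braid_nat.
have := lt_braid r; have:= lt_braid c.
case: (eqVneq l i) => [li|li]; last by rewrite /= !mulr0.
case: (nat_of_ord r) => [|r'] /=; last by rewrite orbT !mulr0.
rewrite ?orbF /= => cj _; move: (nat_of_ord c) cj => {}c cj.
rewrite li in b *.
case: (eqVneq j i) cj => [ji|ji] /=; case: (eqVneq k i) => [ki|ki] //=.
- by rewrite !mulr0.
- move: ki; rewrite ord_eqE neq_ltn ji => /orP[ki|ki].
  + rewrite (lam_lt ki) ki gtr0_sgz ?scale1r; last by lia.
    case: c => [|[|[|?]]] //= _; rewrite ?mulr0 ?subrr ?mul0r ?mulr0 //.
    by rewrite mulr1 mulrACA mulrA mulrA -exprS -!exprD; congr ('X^_ * _); rewrite /ndist; lia.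
  + rewrite (lam_gt ki) [(k < i)%N]ltnNge (ltnW ki) ltr0_sgz ?scaleN1r /=; last by lia.
    case: c => [|[|[|?]]] //= _; rewrite ?mulr0 //.
    rewrite sub0r mulN1r !mulrN; congr (- _).
    rewrite [in RHS]mulrACA [RHS]mulrAC !mulrA -exprS -!exprD -exprSr -mulrA.
    by rewrite -[RHS]mulrA; congr ('X^_ * _); rewrite /ndist; lia.
- by rewrite ki subrr mulr0 ltxx !mulr0.
move=> _; move: ki ji; rewrite !ord_eqE !neq_ltn => /orP[] ki /orP[] ji;
  rewrite ?(lam_lt ki) ?(lam_gt ki) ?(lam_lt ji) ?(lam_gt ji) ?subrr ?mulr0 ?subr0 ?sub0r.
- by rewrite ifF ?mulr0 //; apply/negbTE; rewrite -leNgt mulr_ge0; lia.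
- rewrite ifT; last by rewrite pmulr_llt0; lia.
  rewrite gtr0_sgz ?scale1r; last by lia.
  by rewrite mulr1 mulrACA mulrA mulrA -exprS -!exprD; congr ('X^_ * _); rewrite /ndist; lia.
- rewrite ifT; last by rewrite nmulr_llt0; lia.
  rewrite ltr0_sgz ?scaleN1r; last by lia.
  rewrite !mulrN mulr1; congr (- _).
  by rewrite [RHS]mulrACA [LHS]mulrA [LHS]mulrA -exprS -!exprD; congr ('X^_ * _); rewrite /ndist; lia.
- by rewrite ifF ?mulr0 //; apply/negbTE; rewrite -leNgt mulr_le0; lia.
Qed.

Definition dif_mx_entry k (r c : nat) : {poly K} :=
  if (k == i) && (c == 0%N) then [:: 0; 1; - 'X]`_r else 0.

Definition dif_mx k : 'M[{poly K}]_(rk (B k)) := \matrix_(r, c) dif_mx_entry k r c.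

Lemma dif_braid k (r c : 'I_(rk (B k))) :
  dif (B k) r c = if (k == i) && (c == 0%N :> nat) then [:: 0; 1; - 1]`_r else 0.
Proof.
move: r c; rewrite /braid_obj; case: eqVneq => [_|_] r c /=; rewrite !mxE //.
by case: eqP => [_|] /=; rewrite /bas ?expr0.
Qed.

Lemma emb_mx_dif k : emb_mx (dif (B k)) = dif_mx k.
Proof.
apply/matrixP => r c; rewrite !mxE /dif_mx_entry dif_braid !ob_braid_nat /weight.
have := lt_braid r; case: eqP => [_|_]; last by rewrite mulr0.
case: (nat_of_ord c) => [|?]; last by rewrite mulr0.
case: (nat_of_ord r) => [|[|[|?]]] //= _; rewrite ?mulr0 ?mulr1 //.
  by rewrite -[RHS](expr0 'X); congr ('X^_); lia.
by rewrite subSnn mulrN1.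
Qed.

Lemma aug_beta1_mx k l : aug l *m beta1_mx k l = 'X *: aug k.
Proof.
apply/matrixP => r c; rewrite !mxE.
under eq_bigr do rewrite !mxE.
rewrite (sum_braid l (fun m => aug_entry l m * beta1_mx_entry k l m c)).
rewrite /beta1_mx_entry /aug_entry; have := lt_braid c.
case: (eqVneq l i) => [_|_] /=; last by rewrite mul1r.
case: (eqVneq k i) => _ /=; first by case: (nat_of_ord c) => [|[|[|?]]] //= _; ring.
by move=> _; ring.
Qed.

Lemma aug_dif_mx k : aug k *m dif_mx k = 0.
Proof.
apply/matrixP => r c; rewrite !mxE.
under eq_bigr do rewrite !mxE.
rewrite (sum_braid k (fun m => aug_entry k m * dif_mx_entry k m c)).
rewrite /dif_mx_entry /aug_entry.
case: (eqVneq k i) => [_|_] /=; last by rewrite mulr0.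
by case: ifP => _ /=; ring.
Qed.

Lemma dif_mx_beta1_mx k l : dif_mx l *m beta1_mx k l = beta1_mx k l *m dif_mx k.
Proof.
apply/matrixP => r c; rewrite !mxE.
under eq_bigr do rewrite !mxE.
under [RHS]eq_bigr do rewrite !mxE.
rewrite (sum_braid l (fun m => dif_mx_entry l r m * beta1_mx_entry k l m c)).
rewrite (sum_braid k (fun m => beta1_mx_entry k l r m * dif_mx_entry k m c)).
have := lt_braid r; have := lt_braid c.
rewrite /dif_mx_entry /beta1_mx_entry /aug_entry.
case: (eqVneq k i) => [_|_] /=; case: (eqVneq l i) => [_|_] /=;
  case: (nat_of_ord c) => [|[|[|?]]] //= _; case: (nat_of_ord r) => [|[|[|?]]] //= _; ring.
Qed.

(** The equation of an A-infinity functor on two composable maps, reduced to an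
    identity between constant matrices. It holds for any values of [lam]. *)
Lemma beta1_mx_mul j k l :
  beta1_mx k l *m beta1_mx j k =
    'X *: (beta1_mx j l +
           (dif_mx l *m beta2_mx j k l + beta2_mx j k l *m dif_mx j)).
Proof.
apply/matrixP => r c; rewrite !mxE.
under eq_bigr do rewrite !mxE.
under [X in _ + (X + _)]eq_bigr do rewrite !mxE.
under [X in _ + (_ + X)]eq_bigr do rewrite !mxE.
rewrite (sum_braid k (fun m => beta1_mx_entry k l r m * beta1_mx_entry j k m c)).
rewrite (sum_braid l (fun m => dif_mx_entry l r m * beta2_mx_entry j k l m c)).
rewrite (sum_braid j (fun m => beta2_mx_entry j k l r m * dif_mx_entry j m c)).
have := lt_braid r; have := lt_braid c.
rewrite /dif_mx_entry /beta1_mx_entry /beta2_mx_entry /aug_entry.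
case: (eqVneq k i) => [_|_] /=; case: (eqVneq l i) => [_|_] /=; case: (eqVneq j i) => [_|_] /=;
  case: (nat_of_ord c) => [|[|[|?]]] //= _; case: (nat_of_ord r) => [|[|[|?]]] //= _; ring.
Qed.

(** The augmentation is natural: after it, the braiding functor becomes the
    identity functor. *)
Lemma aug_beta1 k l (b : mor K k l) : aug l *m emb_mx (beta1 i b) = emb b *: aug k.
Proof.
apply: scaleX_inj; rewrite scalemxAr emb_mx_beta1 -scalemxAr aug_beta1_mx.
by rewrite !scalerA mulrC.
Qed.

Lemma dif_beta1 k l (b : mor K k l) :
  dif_mx l *m emb_mx (beta1 i b) = emb_mx (beta1 i b) *m dif_mx k.
Proof.
apply: scaleX_inj.
by rewrite scalemxAr scalemxAl emb_mx_beta1 -scalemxAr -scalemxAl dif_mx_beta1_mx.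
Qed.

(** The homotopy [beta^2] measures the failure of [beta^1] to respect
    composition. *)
Lemma beta_comp j k l (b : mor K k l) (a : mor K j k) :
  emb_mx (beta1 i b) *m emb_mx (beta1 i a) = emb_mx (beta1 i (mor_comp b a)) +
    (dif_mx l *m emb_mx (beta2 i b a) + emb_mx (beta2 i b a) *m dif_mx j).
Proof.
apply: scaleX_inj; apply: scaleX_inj.
have -> : 'X *: ('X *: (emb_mx (beta1 i b) *m emb_mx (beta1 i a))) =
          ('X *: emb_mx (beta1 i b)) *m ('X *: emb_mx (beta1 i a)).
  by rewrite -scalemxAl -scalemxAr.
rewrite !emb_mx_beta1 -scalemxAl -scalemxAr beta1_mx_mul [in RHS]scalerDr emb_mx_beta1 emb_comp.
have -> : 'X *: (dif_mx l *m emb_mx (beta2 i b a) + emb_mx (beta2 i b a) *m dif_mx j) =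
          (emb b * emb a) *: (dif_mx l *m beta2_mx j k l + beta2_mx j k l *m dif_mx j).
  by rewrite scalerDr scalemxAr scalemxAl emb_mx_beta2 -scalemxAr -scalemxAl scalerDr.
by rewrite -!scalerDr !scalerA; congr (_ *: _); ring.
Qed.

Lemma beta1_linear j k t (a b : mor K j k) :
  beta1 i (t *: a + b) = t%:P *: beta1 i a + beta1 i b.
Proof.
apply/matrixP => r c; rewrite !mxE /beta1_entry -mul_polyC.
by do ![case: ifP => _ //]; rewrite ?(mulr0, addr0) //; ring.
Qed.

End Braid.

(** * Degrees, and the differential on short strings *)
Section Degrees.
Variables (K : fieldType) (N : nat).
Implicit Types (x y z : 'I_N.+1).

Lemma twcomp_homog e e' (X Y Z : tw K N) (g : twmor Y Z) (f : twmor X Y) :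
  tw_homog e g -> tw_homog e' f -> tw_homog (e + e') (twcomp g f).
Proof.
move=> gD fD r c rc; rewrite mxE big1 // => m _; rewrite /mor_comp.
case: (eqVneq (dg r - dg m) e) => [E|/gD->]; last by rewrite mul0r mulr0.
rewrite [f m c]fD ?mulr0 //; apply: contra_neq rc => <-; rewrite -E.
by rewrite addrA subrK.
Qed.

Lemma homog_linear e (X Y : tw K N) t (f f' : twmor X Y) :
  tw_homog e f -> tw_homog e f' -> tw_homog e (t *: f + f').
Proof. by move=> fD f'D r c rc; rewrite !mxE fD // f'D // mulr0 addr0. Qed.

(** Degrees are integer expressions that agree only up to ring identities. *)
Lemma homog_cast e e' (X Y : tw K N) (f : twmor X Y) :
  tw_homog e f -> e = e' -> tw_homog e' f.
Proof. by move=> fD <-. Qed.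

Lemma homog0 e (X Y : tw K N) : tw_homog e (0 : twmor X Y).
Proof. by move=> r c _; rewrite mxE. Qed.

Lemma homogD e (X Y : tw K N) (f f' : twmor X Y) :
  tw_homog e f -> tw_homog e f' -> tw_homog e (f + f').
Proof. by move=> fD f'D; rewrite -[f]scale1r; apply: homog_linear. Qed.

Lemma homogZ e (X Y : tw K N) t (f : twmor X Y) : tw_homog e f -> tw_homog e (t *: f).
Proof. by move=> fD; rewrite -[_ *: _]addr0; apply: homog_linear => //; apply: homog0. Qed.

Lemma homogN e (X Y : tw K N) (f : twmor X Y) : tw_homog e f -> tw_homog e (- f).
Proof. by rewrite -scaleN1r; apply: homogZ. Qed.

Lemma homog_sum e (X Y : tw K N) (I : finType) (F : I -> twmor X Y) :
  (forall m, tw_homog e (F m)) -> tw_homog e (\sum_m F m).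
Proof. by move=> FD; apply: big_ind => //; [exact: homog0 | exact: homogD]. Qed.

Lemma single_homog x y (a : mor K x y) : tw_homog 0 (single_mor a).
Proof. by move=> r c; rewrite subrr eqxx. Qed.

Lemma twcomp_dif_single x (Y : tw K N) (f : twmor (single K x) Y) :
  twcomp f (dif (single K x)) = 0.
Proof. by apply/matrixP => r c; rewrite !mxE big1 // => m _; rewrite /mor_comp mxE !mulr0. Qed.

Lemma chain_size_take x y (c : chain K x y) m :
  (m <= chain_size c)%N -> chain_size (chain_take c m) = m.
Proof. by elim: c m => [x0|x0 x1 y0 a c IH] [|m] //= /IH ->. Qed.

Lemma chain_size_drop x y (c : chain K x y) m :
  chain_size (chain_drop c m) = (chain_size c - m)%N.
Proof. by elim: c m => [x0|x0 x1 y0 a c IH] [|m] //=; rewrite IH subSS. Qed.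

Lemma chain_size_merge x y (c : chain K x y) n :
  (n < (chain_size c).-1)%N -> chain_size (chain_merge c n) = (chain_size c).-1.
Proof.
elim: c n => [x0|x0 x1 y0 a c IH] [|n] //=.
  by case: c a {IH}.
by case: (chain_size c) IH => // m IH /IH /= ->.
Qed.

Variable i : 'I_N.+1.
Notation B := (braid_obj K i).

Lemma beta1_homog y z (b : mor K y z) : tw_homog 0 (beta1 i b).
Proof.
move=> r c; rewrite !dg_braid mxE /beta1_entry.
case: (eqVneq z i) => _ /=; case: (eqVneq y i) => _ //=.
- by case: (nat_of_ord r) => [|?]; case: (nat_of_ord c).
- by rewrite /side; case: (nat_of_ord r) => [|?] //= _; case: ifP => //; case: ifP.
- by case: (nat_of_ord c).
Qed.

Lemma beta2_homog x y z (b : mor K y z) (a : mor K x y) : tw_homog (-1) (beta2 i b a).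
Proof.
move=> r c; rewrite !dg_braid mxE /beta2_entry.
case: (eqVneq z i) => _ //=; case: (nat_of_ord r) => [|?] //=.
case: (eqVneq x i) => _ //=.
by case: (nat_of_ord c) => [|?] // _; rewrite ifF //; case: ifP; rewrite andbF.
Qed.

Lemma braid_homog x y (c : chain K x y) :
  (0 < chain_size c)%N -> tw_homog (1 - (chain_size c)%:Z) (functor_comp (braid K i) c).
Proof.
case: c => [//|x0 x1 y0 a c] _; case: c a => [x2 a|x2 x3 x4 b c a] /=.
  exact: beta1_homog.
case: c b => [x5 b|*] /=; first exact: beta2_homog.
exact: homog0.
Qed.

Lemma mu1_homog g (f : cochain (braid K i)) :
  (forall x y (c : chain K x y), tw_homog (g - (chain_size c)%:Z) (f x y c)) ->
  forall x y (c : chain K x y), tw_homog (g + 1 - (chain_size c)%:Z) (mu1 g f c).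
Proof.
move=> fD x y c; rewrite /mu1; set d := chain_size c.
apply: homogD; [apply: homogD; [apply: homogD|]|apply: homogN].
- apply: homogD.
    apply: homogZ; apply: (homog_cast (twcomp_homog (@dif_deg _ _ (B y)) (fD _ _ c))).
    by rewrite -/d; ring.
  by rewrite twcomp_dif_single oppr0; exact: homog0.
- apply: homog_sum => m; apply: homogZ.
  have d0 : (0 < chain_size (chain_drop c m))%N by rewrite chain_size_drop subn_gt0.
  apply: (homog_cast (twcomp_homog (braid_homog d0) (fD _ _ (chain_take c m)))).
  rewrite chain_size_drop chain_size_take ?(ltnW (ltn_ord m)) // -/d.
  by rewrite -subzn ?(ltnW (ltn_ord m)) //; ring.
- apply: homogZ; rewrite {}/d; case: c => [x0|x0 x1 y0 a c] /=; first exact: homog0.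
  apply: homogZ; apply: (homog_cast (twcomp_homog (fD _ _ c) (single_homog a))).
  by rewrite intS; ring.
- apply: homog_sum => n; apply: homogZ.
  apply: (homog_cast (fD _ _ (chain_merge c n))); rewrite chain_size_merge // -/d.
  have d0 : (0 < d)%N by apply: leq_trans (leq_pred _); apply: leq_ltn_trans (ltn_ord n).
  by rewrite -[in RHS](prednK d0) intS; ring.
Qed.

Notation cochain := (cochain (braid K i)).

(** The evaluation of the sums in [mu1] leaves the constructor [Posz 0] rather
    than the zero of the ring of integers. *)
Lemma intB0 (g : int) : g - 0%:Z = g.
Proof. exact: subr0. Qed.

Lemma int0D (g : int) : 0%:Z + g = g.
Proof. exact: add0r. Qed.

Lemma twsign0 : twsign K 0 = 1.
Proof. exact: expr0z. Qed.

Hypotheses (i_gt0 : (0 < i)%N) (i_ltN : (i < N)%N).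

Lemma mu1_1 g (f : cochain) x y (a : mor K x y) :
  emb_col (mu1 g f (consc a (nilc K y))) =
    twsign K (g - 1) *: (dif_mx K i y *m emb_col (f _ _ (consc a (nilc K y))))
    + twsign K g *: (emb_mx (beta1 i a) *m emb_col (f _ _ (nilc K x)))
    + twsign K (g - 1) *: (emb a *: emb_col (f _ _ (nilc K y))).
Proof.
rewrite /mu1 /= big_ord0 subr0 big_ord1 /= !(emb_colD, emb_colZ).
rewrite twcomp_dif_single oppr0 emb_col0 addr0.
by rewrite emb_col_single !emb_col_comp emb_mx_dif // intB0 twsign0 scale1r.
Qed.

Lemma mu1_2 g (f : cochain) x y z (a : mor K x y) (b : mor K y z) :
  emb_col (mu1 g f (consc a (consc b (nilc K z)))) =
    twsign K (g - 2%:Z) *: (dif_mx K i z *m emb_col (f _ _ (consc a (consc b (nilc K z)))))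
    + (twsign K g *: (emb_mx (beta2 i b a) *m emb_col (f _ _ (nilc K x)))
       + twsign K (g - 1) *: (emb_mx (beta1 i b) *m emb_col (f _ _ (consc a (nilc K y)))))
    + twsign K (g - 1) *: (emb a *: emb_col (f _ _ (consc b (nilc K z))))
    - twsign K (g - 1) *: emb_col (f _ _ (consc (mor_comp b a) (nilc K z))).
Proof.
rewrite /mu1 /= !big_ord_recl !big_ord0 /= !(emb_colD, emb_colN, emb_colZ).
rewrite twcomp_dif_single oppr0 !emb_col0 !addr0.
rewrite emb_col_single !emb_col_comp emb_mx_dif // twsign0 scale1r /bump /= oppr0 !addr0.
by rewrite int0D.
Qed.

Lemma mu1_3 g (f : cochain) w x y z (a : mor K w x) (b : mor K x y) (c : mor K y z) :
  emb_col (mu1 g f (consc a (consc b (consc c (nilc K z))))) =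
    twsign K (g - 3%:Z) *:
      (dif_mx K i z *m emb_col (f _ _ (consc a (consc b (consc c (nilc K z))))))
    + (twsign K (g - 1) *: (emb_mx (beta2 i c b) *m emb_col (f _ _ (consc a (nilc K x))))
       + twsign K (g - 2%:Z) *:
           (emb_mx (beta1 i c) *m emb_col (f _ _ (consc a (consc b (nilc K y))))))
    + twsign K (g - 1) *: (emb a *: emb_col (f _ _ (consc b (consc c (nilc K z)))))
    - (twsign K (g - 1) *: emb_col (f _ _ (consc (mor_comp b a) (consc c (nilc K z))))
       + twsign K g *: emb_col (f _ _ (consc a (consc (mor_comp c b) (nilc K z))))).
Proof.
rewrite /mu1 /= !big_ord_recl !big_ord0 /= !(emb_colD, emb_colN, emb_colZ).
rewrite twcomp_dif_single oppr0 !emb_col0 !addr0.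
rewrite emb_col_single !emb_col_comp emb_mx_dif // twsign0 scale1r /bump /= oppr0 !addr0 !int0D.
by rewrite !addn0 emb_mx0 mul0mx scaler0 add0r (addrC 1%:Z g) addrK.
Qed.

End Degrees.

(** * Exactness of the cone, cocycles and coboundaries *)
Section Cocycles.
Variables (K : fieldType) (N : nat) (i : 'I_N.+1).
Hypotheses (i_gt0 : (0 < i)%N) (i_ltN : (i < N)%N).
Implicit Types (j k l x y z : 'I_N.+1).
Notation B := (braid_obj K i).
Notation cochain := (cochain (braid K i)).

(** A column over the complex at [i] is determined by its top entry, its entry
    in [T_{i-1}] and its augmentation; at any other position the augmentation
    alone determines it. *)
Definition top_row k : 'rV[{poly K}]_(rk (B k)) :=
  \row_r ((k == i) && (r == 0%N :> nat))%:R.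

Definition mid_row k : 'rV[{poly K}]_(rk (B k)) :=
  \row_r ((k == i) && (r == 1%N :> nat))%:R.

(** The component of the differential into [T_{i-1}] is [q_{i-1} = v = 1], so
    the differential can be inverted by reading that entry. *)
Lemma mid_dif_mx k : mid_row k *m dif_mx K i k = top_row k.
Proof.
apply/matrixP => r c; rewrite !mxE; under eq_bigr do rewrite !mxE.
rewrite (sum_braid i k (fun m => ((k == i) && (m == 1%N))%:R * dif_mx_entry K i k m c)).
rewrite /dif_mx_entry; case: (eqVneq k i) => _ /=; last by rewrite mul0r.
by case: ifP => _ /=; ring.
Qed.

Lemma top_dif_mx k : top_row k *m dif_mx K i k = 0.
Proof.
apply/matrixP => r c; rewrite !mxE; under eq_bigr do rewrite !mxE.
rewrite (sum_braid i k (fun m => ((k == i) && (m == 0%N))%:R * dif_mx_entry K i k m c)).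
rewrite /dif_mx_entry; case: (eqVneq k i) => _ /=; last by rewrite mul0r.
by case: ifP => _ /=; ring.
Qed.

Lemma emb_col_eq0 k (v : 'cV[{poly K}]_(rk (B k))) :
  top_row k *m v = 0 -> mid_row k *m v = 0 -> aug K i k *m v = 0 -> v = 0.
Proof.
move=> /matrixP/(_ ord0 ord0) + /matrixP/(_ ord0 ord0) + /matrixP/(_ ord0 ord0).
rewrite !mxE.
under eq_bigr do rewrite !mxE.
under [X in _ -> X = _ -> _]eq_bigr do rewrite !mxE.
under [X in _ -> _ -> X = _ -> _]eq_bigr do rewrite !mxE.
pose F n := oapp (v^~ ord0) 0 (insub n : option 'I_(rk (B k))).
have Fv (m : 'I_(rk (B k))) : v m ord0 = F m by rewrite /F valK.
under eq_bigr do rewrite Fv.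
under [X in _ -> X = _ -> _]eq_bigr do rewrite Fv.
under [X in _ -> _ -> X = _ -> _]eq_bigr do rewrite Fv.
rewrite (sum_braid i k (fun m => ((k == i) && (m == 0%N))%:R * F m)).
rewrite (sum_braid i k (fun m => ((k == i) && (m == 1%N))%:R * F m)).
rewrite (sum_braid i k (fun m => aug_entry K i k m * F m)) /aug_entry => v0 v1 v2.
apply/matrixP => r c; rewrite (ord1 c) Fv mxE; have:= lt_braid r.
case: (eqVneq k i) v0 v1 v2 => _ /=; rewrite ?(mul0r, mul1r, add0r, addr0).
  by move=> F0 F1; rewrite F1 mulr0 add0r => F2; case: (nat_of_ord r) => [|[|[|?]]].
by move=> _ _ F0; case: (nat_of_ord r).
Qed.

Lemma dif_mx_inj k (v : 'cV[{poly K}]_(rk (B k))) :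
  mid_row k *m v = 0 -> aug K i k *m v = 0 -> dif_mx K i k *m v = 0 -> v = 0.
Proof.
move=> v1 v2 dv; apply: emb_col_eq0 => //.
by rewrite -mid_dif_mx -mulmxA dv mulmx0.
Qed.

(** All the complexes live in degrees -1 and 0, so a family of degree 1 has
    components on strings of length 1 and 2 only. *)
Lemma homog_void e x y (f : twmor (single K x) (B y)) :
  e != 0 -> e != -1 -> tw_homog e f -> f = 0.
Proof.
move=> e0 e1 fD; apply/matrixP => r c; rewrite [RHS]mxE; apply: fD.
by rewrite dg_braid /= subr0; case: ifP => _; rewrite eq_sym.
Qed.

Lemma homog0_top x y (f : twmor (single K x) (B y)) :
  tw_homog 0 f -> top_row y *m emb_col f = 0.
Proof.
move=> fD; apply/matrixP => r c; rewrite !mxE big1 // => m _; rewrite !mxE.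
case: andP => [[yi m0]|_]; last by rewrite mul0r.
by rewrite fD ?mulr0 // dg_braid yi m0.
Qed.

Lemma homogN1_mid x y (f : twmor (single K x) (B y)) :
  tw_homog (-1) f -> mid_row y *m emb_col f = 0.
Proof.
move=> fD; apply/matrixP => r c; rewrite !mxE big1 // => m _; rewrite !mxE.
case: andP => [[yi m0]|_]; last by rewrite mul0r.
by rewrite fD ?mulr0 // dg_braid yi (eqP m0).
Qed.

Lemma homogN1_aug x y (f : twmor (single K x) (B y)) :
  tw_homog (-1) f -> aug K i y *m emb_col f = 0.
Proof.
move=> fD; apply/matrixP => r c; rewrite !mxE big1 // => m _; rewrite !mxE /aug_entry.
have [yi|yi] := boolP (y == i); last by rewrite fD ?mulr0 // dg_braid (negbTE yi).
case: (eqVneq (m : nat) 0%N) => [->|m0]; first by rewrite /= mul0r.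
by rewrite fD ?mulr0 // dg_braid yi (negbTE m0).
Qed.

Lemma homogN1_inj x y (f : twmor (single K x) (B y)) :
  tw_homog (-1) f -> dif_mx K i y *m emb_col f = 0 -> f = 0.
Proof.
move=> fD df; apply: emb_col_inj; rewrite emb_col0; apply: dif_mx_inj => //.
  exact: homogN1_mid.
exact: homogN1_aug.
Qed.

Lemma homog0_dif_mx x y (f : twmor (single K x) (B y)) :
  tw_homog 0 f -> dif_mx K i y *m emb_col f = 0.
Proof.
move=> fD; rewrite -emb_mx_dif // -emb_col_comp.
have /homog_void -> // := twcomp_homog (@dif_deg _ _ (B y)) fD; last exact: emb_col0.
Qed.

(** The uniform form of the entries of a column: the type of its rows is stuck
    on the test [k == i], so its entries are named by natural numbers. *)
Lemma row_emb_col j k (f : twmor (single K j) (B k)) :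
  exists F : nat -> {poly K}, forall G : nat -> {poly K}, (\row_r G r) *m emb_col f =
    (if k == i then weight K j i * (G 0 * F 0) + weight K j i.-1 * (G 1 * F 1)
                    + weight K j i.+1 * (G 2 * F 2)
     else weight K j k * (G 0 * F 0))%:M.
Proof.
pose F n := oapp (f^~ ord0) 0 (insub n : option 'I_(rk (B k))).
have Fv (m : 'I_(rk (B k))) : f m ord0 = F m by rewrite /F valK.
exists F => G.
apply/matrixP => r c; rewrite (ord1 r) (ord1 c) !mxE.
under eq_bigr do rewrite !mxE ob_braid_nat // Fv.
rewrite (sum_braid i k (fun m => G m *
  (weight K j (if k == i then nth (i : nat) [:: (i : nat); i.-1; i.+1] m else k) * F m))).
by case: (k == i) => /=; rewrite mulr1n; ring.
Qed.

(** The complex at [i] is a part of the Koszul complex of (u, v), which is exact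
    in the middle. *)
Lemma dif_mx_exact j k (f : twmor (single K j) (B k)) :
  tw_homog 0 f -> aug K i k *m emb_col f = 0 ->
  exists2 z : twmor (single K j) (B k), tw_homog (-1) z & dif_mx K i k *m emb_col z = emb_col f.
Proof.
move=> fD af; have [F row_emb_colE] := row_emb_col f.
(* The relation u e1 + v e2 = 0 is solved by (v z, - u z). For j < i the
   entry e1 carries one factor u less than z, and z is read from e2 instead. *)
pose z0 := if (j < i)%N then - F 2 else F 1.
pose z : twmor (single K j) (B k) :=
  \matrix_(r, c) if (k == i) && (r == 0%N :> nat) then z0 else 0.
exists z; first by move=> r c; rewrite dg_braid subr0 mxE; case: ifP.
have tz : top_row k *m emb_col z = (if k == i then weight K j i * z0 else 0)%:M.
  apply/matrixP => r c; rewrite (ord1 r) (ord1 c) !mxE.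
  under eq_bigr do rewrite !mxE ob_braid_nat //.
  rewrite (sum_braid i k (fun m => ((k == i) && (m == 0%N))%:R *
    (weight K j (if k == i then nth (i : nat) [:: (i : nat); i.-1; i.+1] m else k) *
     (if (k == i) && (m == 0%N) then z0 else 0)))).
  by case: (k == i) => /=; rewrite mulr1n; ring.
apply/eqP; rewrite -subr_eq0; apply/eqP; apply: emb_col_eq0.
- by rewrite mulmxBr mulmxA top_dif_mx mul0mx homog0_top ?subr0.
- rewrite mulmxBr mulmxA mid_dif_mx tz /mid_row.
  rewrite (row_emb_colE (fun r => ((k == i) && (r == 1%N))%:R)).
  move: af; rewrite /aug row_emb_colE /aug_entry => /matrixP/(_ ord0 ord0).
  rewrite !mxE !mulr1n => af; apply/matrixP => r c; rewrite (ord1 r) (ord1 c) !mxE !mulr1n.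
  case: (eqVneq k i) af => [_|_] /= af; last by ring.
  rewrite /z0; case: ltnP => ji.
    apply: (mulfI (polyX_neq0 K)); rewrite mulr0 -[RHS]oppr0 -af.
    by rewrite -(weight_succ K (ltnW ji)) -(weight_pred K ji); ring.
  rewrite (_ : weight K j i.-1 = weight K j i); first by ring.
  by rewrite /weight; congr (_ ^+ _); lia.
- by rewrite mulmxBr mulmxA aug_dif_mx mul0mx af subrr.
Qed.

Lemma prenat_nil g (f : cochain) x : is_prenat g f -> g != 0 -> g != -1 -> f _ _ (nilc K x) = 0.
Proof.
move=> [_ fD] g0 g1; have:= fD _ _ (nilc K x); rewrite /= subr0.
exact: homog_void.
Qed.

Lemma twsign1 : twsign K 1 = -1. Proof. exact: expr1z. Qed.

Lemma twsignN1 : twsign K (-1) = -1. Proof. by rewrite /twsign exprN1 invrN1. Qed.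

Lemma prenat1_1 (f : cochain) x y (a : mor K x y) :
  is_prenat 1 f -> tw_homog 0 (f _ _ (consc a (nilc K y))).
Proof. by move=> fP; apply: (homog_cast (fP.2 _ _ (consc a (nilc K y)))). Qed.

Lemma cocycle_2 (f : cochain) x y z (a : mor K x y) (b : mor K y z) : is_prenat 1 f ->
  emb_col (mu1 1 f (consc a (consc b (nilc K z)))) =
    emb_mx (beta1 i b) *m emb_col (f _ _ (consc a (nilc K y)))
    + emb a *: emb_col (f _ _ (consc b (nilc K z)))
    - emb_col (f _ _ (consc (mor_comp b a) (nilc K z)))
    - dif_mx K i z *m emb_col (f _ _ (consc a (consc b (nilc K z)))).
Proof.
move=> fP; rewrite mu1_2 // (prenat_nil _ fP) // emb_col0 mulmx0 scaler0 add0r.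
rewrite subrr twsign0 !scale1r (_ : 1 - 2%:Z = -1) // twsignN1 scaleN1r.
by apply/matrixP => r c'; rewrite !mxE; ring.
Qed.

Lemma cocycle_3 (f : cochain) w x y z (a : mor K w x) (b : mor K x y) (c : mor K y z) :
  is_prenat 1 f ->
  emb_col (mu1 1 f (consc a (consc b (consc c (nilc K z))))) =
    emb_mx (beta2 i c b) *m emb_col (f _ _ (consc a (nilc K x)))
    - emb_mx (beta1 i c) *m emb_col (f _ _ (consc a (consc b (nilc K y))))
    + emb a *: emb_col (f _ _ (consc b (consc c (nilc K z))))
    - emb_col (f _ _ (consc (mor_comp b a) (consc c (nilc K z))))
    + emb_col (f _ _ (consc a (consc (mor_comp c b) (nilc K z)))).
Proof.
move=> fP; rewrite mu1_3 //.
have [_ fD] := fP.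
have /homog_void -> // := fD _ _ (consc a (consc b (consc c (nilc K z)))).
rewrite emb_col0 mulmx0 scaler0 add0r subrr twsign0 !scale1r.
rewrite (_ : 1 - 2%:Z = -1) // twsign1 twsignN1 !scaleN1r.
by apply/matrixP => r c'; rewrite !mxE; ring.
Qed.

(** The cocycle equation on strings of length 3 lies in degree -1, where the
    differential of the cone is injective. Applying it and inserting the equation
    on strings of length 2 reduces the claim to the A-infinity equation of the
    braiding functor. *)
Lemma nat_transP (f : cochain) : is_prenat 1 f ->
  (forall x y z (a : mor K x y) (b : mor K y z),
     dif_mx K i z *m emb_col (f _ _ (consc a (consc b (nilc K z)))) =
     emb_mx (beta1 i b) *m emb_col (f _ _ (consc a (nilc K y)))
       + emb a *: emb_col (f _ _ (consc b (nilc K z)))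
       - emb_col (f _ _ (consc (mor_comp b a) (nilc K z)))) ->
  is_nat_trans 1 f.
Proof.
move=> fP f2; split=> //; apply: cochainP => x y c.
have fD : tw_homog (1 + 1 - (chain_size c)%:Z) (mu1 1 f c) by apply: mu1_homog; exact: fP.2.
have [c2|c3|]: [\/ chain_size c = 2, chain_size c = 3 |
   (1 + 1 - (chain_size c)%:Z != 0) && (1 + 1 - (chain_size c)%:Z != -1)].
  case: (chain_size c) => [|[|[|[|n]]]];
    by [constructor 1 | constructor 2 | constructor 3; lia].
- case: c c2 {fD} => [//|x0 x1 y0 a c]; case: c a => [//|x2 x3 y1 b c] a.
  case: c b => [//|//] x4 b _.
  apply: emb_col_inj; rewrite cocycle_2 // f2 subrr.
  exact/esym/emb_col0.
- case: c c3 fD => [//|x0 x1 y0 a c]; case: c a => [//|x2 x3 y1 b c] a.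
  case: c b => [//|x4 x5 y2 c c'] b; case: c' c => [//|//] x6 c _ fD.
  apply: homogN1_inj => //; rewrite cocycle_3 //.
  have f1D := prenat1_1 a fP.
  rewrite !(mulmxDr, mulmxN) -scalemxAr !f2 !mulmxA dif_beta1 // -!mulmxA f2.
  have -> : dif_mx K i x6 *m (emb_mx (beta2 i c b) *m emb_col (f _ _ (consc a (nilc K x2)))) =
     emb_mx (beta1 i c) *m (emb_mx (beta1 i b) *m emb_col (f _ _ (consc a (nilc K x2))))
     - emb_mx (beta1 i (mor_comp c b)) *m emb_col (f _ _ (consc a (nilc K x2))).
    rewrite [in RHS]mulmxA beta_comp // !mulmxDl -[X in _ + (_ + X)]mulmxA homog0_dif_mx //.
    by rewrite mulmx0 addr0 addrC addKr mulmxA.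
  rewrite !(mulmxDr, mulmxN) -!scalemxAr !(mulmxDr, scalerDr, mulmxN, scalerN) scalerA.
  by rewrite emb_comp mor_compA !mulmxA; apply/matrixP => r s; rewrite !mxE; ring.
- by case/andP=> d0 d1; apply: homog_void fD.
Qed.

Lemma coboundary_1 (h : cochain) x y (a : mor K x y) :
  emb_col (mu1 0 h (consc a (nilc K y))) =
    emb_mx (beta1 i a) *m emb_col (h _ _ (nilc K x)) - emb a *: emb_col (h _ _ (nilc K y))
    - dif_mx K i y *m emb_col (h _ _ (consc a (nilc K y))).
Proof.
rewrite mu1_1 // sub0r twsignN1 twsign0 !scale1r !scaleN1r.
by apply/matrixP => r c; rewrite !mxE; ring.
Qed.

Lemma coboundary_2 (h : cochain) x y z (a : mor K x y) (b : mor K y z) : is_prenat 0 h ->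
  emb_col (mu1 0 h (consc a (consc b (nilc K z)))) =
    emb_mx (beta2 i b a) *m emb_col (h _ _ (nilc K x))
    - emb_mx (beta1 i b) *m emb_col (h _ _ (consc a (nilc K y)))
    - emb a *: emb_col (h _ _ (consc b (nilc K z)))
    + emb_col (h _ _ (consc (mor_comp b a) (nilc K z))).
Proof.
move=> hP; rewrite mu1_2 // !sub0r twsignN1 twsign0.
have /homog_void -> // := hP.2 _ _ (consc a (consc b (nilc K z))).
rewrite emb_col0 mulmx0 scaler0 add0r !scale1r !scaleN1r.
by apply/matrixP => r c; rewrite !mxE; ring.
Qed.

Lemma prenat0_nil (h : cochain) x : is_prenat 0 h -> tw_homog 0 (h _ _ (nilc K x)).
Proof. by move=> hP; apply: (homog_cast (hP.2 _ _ (nilc K x))). Qed.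

(** By the same injectivity, the component on strings of length 2 of a cocycle
    is determined by its component on strings of length 1. *)
Lemma cocycle_eq_coboundary (f h : cochain) : is_nat_trans 1 f -> is_prenat 0 h ->
  (forall x y (a : mor K x y),
     emb_col (f _ _ (consc a (nilc K y))) = emb_col (mu1 0 h (consc a (nilc K y)))) ->
  f = mu1 0 h.
Proof.
move=> [fP f0] hP fh; apply: cochainP => x y c.
have uD : tw_homog (0 + 1 - (chain_size c)%:Z) (mu1 0 h c) by apply: mu1_homog; exact: hP.2.
have fD := fP.2 _ _ c; move: uD; rewrite add0r => uD.
have [c1|c2|/andP[d0 d1]]: [\/ chain_size c = 1, chain_size c = 2 |
   (1 - (chain_size c)%:Z != 0) && (1 - (chain_size c)%:Z != -1)].
  case: (chain_size c) => [|[|[|n]]];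
    by [constructor 1 | constructor 2 | constructor 3; lia].
- case: c c1 {fD uD} => [//|x0 x1 y0 a c]; case: c a => [|//] x2 a _.
  by apply: emb_col_inj.
- case: c c2 fD uD => [//|x0 x1 y0 a c]; case: c a => [//|x2 x3 y1 b c] a.
  case: c b => [|//] x4 b _ fD uD.
  apply/eqP; rewrite -subr_eq0; apply/eqP; apply: homogN1_inj.
    by apply: homogD => //; apply: homogN.
  rewrite emb_colD emb_colN mulmxBr coboundary_2 //.
  have -> : dif_mx K i x4 *m emb_col (f _ _ (consc a (consc b (nilc K x4)))) =
     emb_mx (beta1 i b) *m emb_col (f _ _ (consc a (nilc K x2)))
       + emb a *: emb_col (f _ _ (consc b (nilc K x4)))
       - emb_col (f _ _ (consc (mor_comp b a) (nilc K x4))).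
    apply/esym/eqP; rewrite -subr_eq0 -cocycle_2 // f0; apply/eqP; exact: emb_col0.
  have h0D : tw_homog 0 (h _ _ (nilc K x0)) by exact: prenat0_nil.
  rewrite !fh !coboundary_1 !(mulmxDr, mulmxN) emb_comp.
  have -> : dif_mx K i x4 *m (emb_mx (beta2 i b a) *m emb_col (h _ _ (nilc K x0))) =
     emb_mx (beta1 i b) *m (emb_mx (beta1 i a) *m emb_col (h _ _ (nilc K x0)))
     - emb_mx (beta1 i (mor_comp b a)) *m emb_col (h _ _ (nilc K x0)).
    rewrite [in RHS]mulmxA beta_comp // !mulmxDl -[X in _ + (_ + X)]mulmxA homog0_dif_mx //.
    by rewrite mulmx0 addr0 addrC addKr mulmxA.
  rewrite -!scalemxAr !mulmxA dif_beta1 //.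
  by apply/matrixP => r s; rewrite !mxE; ring.
- by rewrite (homog_void d0 d1 fD) (homog_void d0 d1 uD).
Qed.

Lemma mid_beta1 k l (b : mor K k l) :
  'X *: (mid_row l *m emb_mx (beta1 i b)) =
    if l != i then 0
    else if k == i then ('X * emb b) *: mid_row k
    else (emb b * lam K i k) *: aug K i k.
Proof.
rewrite scalemxAr emb_mx_beta1 // -scalemxAr; apply/matrixP => r c; rewrite (ord1 r).
rewrite !mxE; under eq_bigr do rewrite !mxE.
rewrite (sum_braid i l (fun m => ((l == i) && (m == 1%N))%:R * beta1_mx_entry K i k l m c)).
rewrite /beta1_mx_entry; case: (eqVneq l i) => [_|_] /=; last by rewrite mul0r mulr0 mxE.
case: (eqVneq k i) => [/eqP ki|ki] /=; rewrite !mxE ?ki /=.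
  by rewrite (eq_sym 1%N); ring.
by rewrite /aug_entry (negbTE ki); ring.
Qed.

End Cocycles.

(** * Cohomology classes *)
Section Cohomology.
Variables (K : fieldType) (N : nat) (B : functor_data K N) (g : int).

Lemma HH_class_linear t (f f' : nat_trans B g) :
  HH_class (t *: f + f') = t *: HH_class f + HH_class f'.
Proof. by rewrite /HH_class pi_lmod_add pi_lmod_scale. Qed.

Lemma HH_class_eqP (f f' : nat_trans B g) :
  HH_class f = HH_class f' <-> is_coboundary (f - f').
Proof.
split=> [/eqP | fP].
  by rewrite -Quotient.idealrBE => /asboolP.
by apply/eqP; rewrite -Quotient.idealrBE; apply/asboolP.
Qed.

End Cohomology.

(** * Euler derivations *)
Section Euler.
Variables (K : fieldType).
Implicit Types p q : {poly K}.

Lemma linear_polyE (G : {poly K} -> {poly K}) p : linear G ->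
  \sum_(n < size p) p`_n *: G 'X^n = G p.
Proof.
move=> linG.
pose G' : {linear {poly K} -> {poly K}} := HB.pack G (GRing.isLinear.Build K _ _ _ G linG).
rewrite -[in RHS](coefK p) poly_def -[RHS]/(G' _) linear_sum.
by apply: eq_bigr => n _; rewrite linearZ.
Qed.

(** Twice the degree operator on polynomials, shifted by [d]: it multiplies ['X^n]
    by [2 n + d], which is the coefficient [q] of the formulas for [eta]. *)
Definition euler (d : int) p : {poly K} := 'X * p^`() *+ 2 + d%:~R * p.

Lemma euler_is_linear d : linear (euler d).
Proof. by move=> t p q; rewrite /euler derivD derivZ -!mul_polyC; ring. Qed.

Lemma eulerXn d n : euler d 'X^n = (n%:Z *+ 2 + d)%:~R *: 'X^n.
Proof.
rewrite /euler; have -> : 'X * ('X^n)^`() = 'X^n *+ n :> {poly K}.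
  by rewrite derivXn; case: n => [|n] /=; rewrite ?mulr0n ?mulr0 // exprS mulrnAr.
by rewrite scaler_int mulrzDr mulrzl -pmulrn mulr2n mulrnDr.
Qed.

Lemma eulerM c d p q : euler (c + d) (p * q) = euler c p * q + p * euler d q.
Proof. by rewrite /euler derivM; ring. Qed.

Lemma eulerMXn d n p : 'X^n * euler (d + n%:Z *+ 2) p = euler d ('X^n * p).
Proof.
rewrite -[d in RHS]add0r eulerM eulerXn addr0 scaler_int -mulrzl.
by rewrite /euler [(d + _)%:~R]rmorphD /=; ring.
Qed.

(** After the embedding the absolute value of [j - k] becomes a signed
    difference, which is additive along compositions. *)
Lemma weight_euler (j k : nat) p :
  weight K j k * euler (ndist j k) p = euler (j%:Z - k%:Z) (weight K j k * p).
Proof.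
by rewrite /weight -eulerMXn; congr (_ * euler _ _); rewrite /ndist; lia.
Qed.

End Euler.

(** * Closed forms of the components of eta *)
Section Eta.
Variables (K : fieldType) (N : nat) (i : 'I_N.+1) (sigma : {poly K}).
Implicit Types (j k l x y z : 'I_N.+1).
Notation B := (braid_obj K i).

Let hs : {poly K} := 2^-1 *: sigma.

Lemma sum_half_shift n :
  \sum_(l < size sigma) (2^-1 * sigma`_l) *: 'X^(n + l) = hs * 'X^n.
Proof.
rewrite /hs -[in RHS](coefK sigma) poly_def scaler_sumr mulr_suml.
by apply: eq_bigr => l _; rewrite scalerA -scalerAl -exprD addnC.
Qed.

(** In closed form the index shift of the case [k = j = i] is a derivative, and
    its vanishing coefficient is that of the derivative of a constant. *)
Definition eta1_val j k (r : nat) (p : {poly K}) : {poly K} :=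
  if k != i then hs * euler (ndist j k) p
  else if j != i then if r == side i j then hs * euler (ndist j k) p else 0
  else if r == 0%N then 0 else 2^-1 *: (hs * p^`() *+ 2).

Lemma eta1_val_linear j k r : linear (eta1_val j k r).
Proof.
move=> t p q; rewrite /eta1_val; case: ifP => _; first by rewrite euler_is_linear -!mul_polyC; ring.
case: ifP => _; case: ifP => _; rewrite ?(scaler0, addr0) //.
  by rewrite euler_is_linear -!mul_polyC; ring.
by rewrite derivD derivZ -!mul_polyC; ring.
Qed.

Lemma qcoef_euler j k n : qcoef K j k n *: 'X^n = euler (ndist j k) 'X^n.
Proof. by rewrite eulerXn /qcoef pmulrn; congr (_%:~R *: _); lia. Qed.

Lemma eta1_basis_val j k r n : eta1_basis i sigma j k r n = eta1_val j k r 'X^n.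
Proof.
rewrite /eta1_basis /eta1_val /bas.
have E : qcoef K j k n *: (\sum_(l < size sigma) (2^-1 * sigma`_l) *: 'X^(n + l)) =
         hs * euler (ndist j k) 'X^n.
  by rewrite sum_half_shift -qcoef_euler scalerAr.
case: eqVneq => [ki|_] //=; case: eqVneq => [ji|_] //=; last first.
  case: eqP => _ //; rewrite big1 ?scaler0 // => l _; exact: scaler0.
case: eqP => _; first by rewrite big1 ?scaler0 // => l _; exact: scaler0.
rewrite ki ji derivXn; case: n {E} => [|n].
  by rewrite /qcoef /ndist subrr /= scale0r mulr0n mulr0 mul0rn scaler0.
under eq_bigr do rewrite scalerA mulrC -scalerA addSn /=.
rewrite -scaler_sumr sum_half_shift /qcoef /ndist subrr absz0 addn0 mulnC.
by rewrite mulrnAr -mulrnA -scaler_nat !scalerA mulrC.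
Qed.

Lemma eta1E j k r (a : {poly K}) :
  \sum_(n < size a) a`_n *: eta1_basis i sigma j k r n = eta1_val j k r a.
Proof.
under eq_bigr do rewrite eta1_basis_val.
by rewrite linear_polyE //; exact: eta1_val_linear.
Qed.

Definition eta2_val j k l (r : nat) (b a : {poly K}) : {poly K} :=
  if (l != i) || (r != 0%N) then 0
  else if ((k < i) && (i < j) || (j < i) && (i < k))%N then
    (sgz (i%:Z - k%:Z))%:~R *:
      (hs * ('X^((delta j k i).-1) * euler ((2 * delta j k i + ndist j i)%N) (b * a)))
  else if k == i then (sgz (j%:Z - i%:Z))%:~R *: (2^-1 *: (hs * (b^`() *+ 2 * a)))
  else if j == i then (sgz (i%:Z - k%:Z))%:~R *: (2^-1 *:
      (hs * ('X^((delta j k i).-1) * euler ((2 * delta j k i + ndist j i)%N) (b * a))))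
  else 0.

Lemma eta2_val_linearl j k l r a : linear (fun b => eta2_val j k l r b a).
Proof.
move=> t p q; rewrite /eta2_val; case: ifP => _; first by rewrite scaler0 addr0.
rewrite (mulrDl _ _ a) -(scalerAl t p a) derivD derivZ euler_is_linear.
case: ifP => _; first by rewrite -!mul_polyC; ring.
case: ifP => _; first by rewrite -!mul_polyC; ring.
case: ifP => _; first by rewrite -!mul_polyC; ring.
by rewrite scaler0 addr0.
Qed.

Lemma eta2_val_linearr j k l r b : linear (eta2_val j k l r b).
Proof.
move=> t p q; rewrite /eta2_val; case: ifP => _; first by rewrite scaler0 addr0.
rewrite (mulrDr b) -(scalerAr t b p) euler_is_linear.
case: ifP => _; first by rewrite -!mul_polyC; ring.
case: ifP => _; first by rewrite -!mul_polyC; ring.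
case: ifP => _; first by rewrite -!mul_polyC; ring.
by rewrite scaler0 addr0.
Qed.

Lemma eta2_basis_val j k l r m n :
  eta2_basis i sigma j k l r m n = eta2_val j k l r 'X^m 'X^n.
Proof.
rewrite /eta2_basis /eta2_val /bas; case: ifP => // _.
have E : k != i -> ~~ ((k < i) && (j < i) || (i < k) && (i < j))%N ->
   qcoef K j i (m + n + delta j k i) *:
     (\sum_(l < size sigma) (2^-1 * sigma`_l) *: 'X^((m + n + delta j k i + l).-1)) =
   hs * ('X^((delta j k i).-1) * euler ((2 * delta j k i + ndist j i)%N) ('X^m * 'X^n)).
  rewrite ord_eqE => ki kij.
  have [d E] : exists d, delta j k i = d.+1.
    by exists (delta j k i).-1; move: kij ki; rewrite /delta /ndist; lia.
  rewrite E; under eq_bigr do rewrite addnS addSn /=.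
  rewrite sum_half_shift -exprD eulerXn -(scalerAr _ 'X^d) -(scalerAr _ hs) -exprD.
  rewrite [(m + n + d)%N]addnC /qcoef pmulrn; congr (_%:~R *: _); lia.
rewrite /Qcoef.
case: ifP => kij; first by rewrite -scalerA E // ?ord_eqE; lia.
case: eqVneq => [ki|ki] //.
  rewrite (_ : delta j k i = 0%N) ?addn0; last by rewrite /delta /ndist ki; lia.
  rewrite -!scalerA; congr (_ *: (_ *: _)); rewrite derivXn.
  case: m {E} => [|m].
    by rewrite /qcoef /ndist ki subrr /= scale0r mulr0n mul0rn mul0r mulr0.
  under eq_bigr do rewrite !addSn /=.
  rewrite sum_half_shift /qcoef /ndist ki subrr absz0 addn0 mulnC.
  by rewrite exprD -mulrnA mulrnAl mulrnAr scaler_nat.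
case: eqVneq => [ji|ji] //; last by rewrite scale0r.
by rewrite -!scalerA E // ji; move: ki; rewrite ord_eqE; lia.
Qed.

Lemma eta2E j k l r (b a : {poly K}) :
  \sum_(m < size b) \sum_(n < size a) (b`_m * a`_n) *: eta2_basis i sigma j k l r m n =
    eta2_val j k l r b a.
Proof.
under eq_bigr => m _.
  under eq_bigr do rewrite eta2_basis_val -scalerA.
  rewrite -scaler_sumr linear_polyE; last exact: eta2_val_linearr.
  over.
by rewrite (linear_polyE _ (eta2_val_linearl j k l r a)).
Qed.

(** The derivation attached to [eta]. It is half of [sigma] times the Euler
    derivation of the grading in which [s] has degree 2 and [a_{kj}] has degree
    the distance of [j] and [k]. *)
Definition sigma_der j k (a : mor K j k) : {poly K} := hs * euler (j%:Z - k%:Z) (emb a).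

Lemma sigma_der_comp j k l (b : mor K k l) (a : mor K j k) :
  sigma_der (mor_comp b a) = emb b * sigma_der a + emb a * sigma_der b.
Proof.
rewrite /sigma_der emb_comp (_ : j%:Z - l%:Z = (k%:Z - l%:Z) + (j%:Z - k%:Z)); last by ring.
by rewrite eulerM; ring.
Qed.

Hypotheses (i_gt0 : (0 < i)%N) (i_ltN : (i < N)%N) (two_neq0 : 2 != 0 :> K).

Lemma halfD : (2^-1)%:P + (2^-1)%:P = 1 :> {poly K}.
Proof. by rewrite -polyCD -mulr2n -[X in X%:P]mulr_natl divff. Qed.

(** For [k = j = i] both summands contribute a half, and two halves make 1. *)
Lemma eta1_aug j k (a : mor K j k) :
  aug K i k *m emb_col (eta1 i sigma a) = (sigma_der a)%:M.
Proof.
apply/matrixP => r c; rewrite (ord1 r) (ord1 c) !mxE.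
under eq_bigr do rewrite !mxE eta1E ob_braid_nat //.
rewrite (sum_braid i k (fun m => aug_entry K i k m *
  (weight K j (if k == i then nth (i : nat) [:: (i : nat); i.-1; i.+1] m else k) *
   eta1_val j k m a))) /eta1_val /aug_entry /sigma_der /emb.
case: (eqVneq k i) => [ki|ki] /=; last by rewrite mul1r mulrCA weight_euler mulr1n.
rewrite ki /side mulr1n -weight_euler mul0r add0r mul1r.
case: (eqVneq j i) => [ji|] /=.
  rewrite ji /weight /ndist subrr absz0 subnn subSnn (_ : (i.-1 - i = 0)%N); last by lia.
  rewrite /euler mul0r addr0 expr0 expr1 !mul1r -!mul_polyC.
  by rewrite -[RHS]mul1r -halfD; ring.
rewrite ord_eqE neq_ltn => /orP[] ji; rewrite ?ji 1?ltnNge ?(ltnW ji) /= ?mulr0 ?add0r ?addr0.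
  by rewrite mulrA weight_pred // mulrCA.
rewrite mulrCA (_ : weight K j i.+1 = weight K j i) //.
by rewrite /weight; congr (_ ^+ _); lia.
Qed.

(** The factor ['X] on the left clears the denominator that the splitting by
    [lam] involves when [j] is at most [i]. *)
Lemma eta1_mid j k (a : mor K j k) :
  'X *: (mid_row K i k *m emb_col (eta1 i sigma a)) =
    (if k == i then lam K i j * sigma_der a else 0)%:M.
Proof.
apply/matrixP => r c; rewrite (ord1 r) (ord1 c) !mxE.
under eq_bigr do rewrite !mxE eta1E ob_braid_nat //.
rewrite (sum_braid i k (fun m => ((k == i) && (m == 1%N))%:R *
  (weight K j (if k == i then nth (i : nat) [:: (i : nat); i.-1; i.+1] m else k) *
   eta1_val j k m a))) /eta1_val /sigma_der /emb.
case: (eqVneq k i) => [ki|ki] /=; last by rewrite !(mul0r, mulr0, mulr1n).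
rewrite ki /side mulr1n -weight_euler !mul0r add0r addr0 mul1r.
case: (eqVneq j i) => [ji|] /=.
  rewrite ji lam_i /weight /ndist subrr absz0 subnn (_ : (i.-1 - i = 0)%N); last by lia.
  rewrite /euler mul0r addr0 expr0 !mul1r -!mul_polyC.
  by ring.
rewrite ord_eqE neq_ltn => /orP[] ji; rewrite ?(lam_lt _ ji) ?(lam_gt _ ji) ?ji.
  by rewrite ltnNge (ltnW ji) /= mulrA weight_pred // mul1r mulrCA.
by rewrite mul0r !mulr0.
Qed.

Lemma half_sub_lam j :
  lam K i i - lam K i j = (sgz (j%:Z - i%:Z))%:~R * (2^-1)%:P.
Proof.
rewrite lam_i; case: (eqVneq j i) => [->|]; first by rewrite lam_i !subrr sgz0 mul0r.
rewrite ord_eqE neq_ltn => /orP[] ji; rewrite ?(lam_lt _ ji) ?(lam_gt _ ji).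
  by rewrite ltr0_sgz; [rewrite mulrN1z mulN1r -halfD opprD addrA subrr add0r | lia].
by rewrite gtr0_sgz; [ring | lia].
Qed.

(** The case distinction defining [Q] is the difference of two values of [lam];
    this is the value that the cocycle equation dictates for [eta^2]. *)
Lemma eta2_top j k l (b : mor K k l) (a : mor K j k) :
  'X *: (top_row K i l *m emb_col (eta2 i sigma b a)) =
    (if l != i then 0
     else if k == i then (lam K i i - lam K i j) * (emb a * sigma_der b)
     else (lam K i k - lam K i j) * sigma_der (mor_comp b a))%:M.
Proof.
apply/matrixP => r c; rewrite (ord1 r) (ord1 c) !mxE.
under eq_bigr do rewrite !mxE eta2E ob_braid_nat //.
rewrite (sum_braid i l (fun m => ((l == i) && (m == 0%N))%:R *
  (weight K j (if l == i then nth (i : nat) [:: (i : nat); i.-1; i.+1] m else l) *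
   eta2_val j k l m b a))) /eta2_val.
case: (eqVneq l i) => [li|li] /=; last by rewrite !(mul0r, mulr0, mulr1n).
rewrite !mul0r !addr0 mul1r mulr1n !half_sub_lam.
subst l.
have E : (0 < delta j k i)%N ->
    'X * (weight K j i * (hs * ('X^((delta j k i).-1) *
       euler (2 * delta j k i + ndist j i)%N ((b : {poly K}) * (a : {poly K}))))) =
    sigma_der (mor_comp b a).
  move=> d0; rewrite /sigma_der /emb /mor_comp -weight_euler.
  rewrite -(eulerMXn (ndist j i)) -{3}(prednK d0) exprS.
  rewrite (_ : (2 * delta j k i + ndist j i)%N%:Z = (ndist j i)%:Z + (delta j k i)%:Z *+ 2); last lia.
  by ring.
have {}E : k != i -> ~~ ((k < i) && (j < i) || (i < k) && (i < j))%N ->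
    'X * (weight K j i * (hs * ('X^((delta j k i).-1) *
       euler (2 * delta j k i + ndist j i)%N ((b : {poly K}) * (a : {poly K}))))) =
    sigma_der (mor_comp b a).
  by rewrite ord_eqE => ki kij; apply: E; move: ki kij; rewrite /delta /ndist; lia.
case: ifP => [kij|kij].
  have ki : k != i by rewrite ord_eqE; lia.
  rewrite (negbTE ki) -!scalerAr E //; last by move: kij; lia.
  rewrite scaler_int -mulrzl; congr (_ * _).
  case/orP: kij => /andP[k1 k2].
    by rewrite (lam_lt _ k1) (lam_gt _ k2) gtr0_sgz ?subr0 //; lia.
  by rewrite (lam_lt _ k1) (lam_gt _ k2) ltr0_sgz ?sub0r ?mulrN1z //; lia.
case: eqVneq => [ki|ki].
  rewrite /sigma_der /emb ki /euler subrr mul0r addr0 /weight subnn expr0 !mul1r -!mul_polyC.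
  by rewrite [_%:~R%:P]rmorph_int; ring.
case: eqVneq => [ji|ji].
  rewrite -!scalerAr E //; last by move: ki; rewrite ji ord_eqE; lia.
  have -> : lam K i k - lam K i j = (sgz (i%:Z - k%:Z))%:~R * (2^-1)%:P.
    by rewrite ji -opprB half_sub_lam -(opprB i%:Z) sgzN mulrNz mulNr opprK.
  by rewrite -!mul_polyC [_%:~R%:P]rmorph_int mulrA.
rewrite !mulr0 (_ : lam K i k - lam K i j = 0) ?mul0r //.
move: ki ji; rewrite !ord_eqE !neq_ltn => /orP[] k1 /orP[] j1; move: kij; rewrite k1 j1 ?orbT //.
  by rewrite (lam_lt _ k1) (lam_lt _ j1) subrr.
by rewrite (lam_gt _ k1) (lam_gt _ j1) subrr.
Qed.

End Eta.

(** * Eta is a natural transformation *)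
Section EtaCocycle.
Variables (K : fieldType) (N : nat) (i : 'I_N.+1).
Implicit Types (j k l x y z : 'I_N.+1) (sigma : {poly K}).
Notation B := (braid_obj K i).
Notation cochain := (cochain (braid K i)).

Lemma eta1_linear sigma j k t (a b : mor K j k) :
  eta1 i sigma (t *: a + b) = t%:P *: eta1 i sigma a + eta1 i sigma b.
Proof.
by apply/matrixP => r c; rewrite !mxE !eta1E // eta1_val_linear -mul_polyC.
Qed.

Lemma eta2_linear_l sigma j k l t (b b' : mor K k l) (a : mor K j k) :
  eta2 i sigma (t *: b + b') a = t%:P *: eta2 i sigma b a + eta2 i sigma b' a.
Proof.
apply/matrixP => r c; rewrite !mxE !eta2E //.
by rewrite (eta2_val_linearl i sigma j k l r a) -mul_polyC.
Qed.

Lemma eta2_linear_r sigma j k l t (b : mor K k l) (a a' : mor K j k) :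
  eta2 i sigma b (t *: a + a') = t%:P *: eta2 i sigma b a + eta2 i sigma b a'.
Proof.
by apply/matrixP => r c; rewrite !mxE !eta2E // eta2_val_linearr -mul_polyC.
Qed.

Lemma eta1_homog sigma j k (a : mor K j k) : tw_homog 0 (eta1 i sigma a).
Proof.
move=> r c; rewrite dg_braid !mxE eta1E // /eta1_val /side /=.
case: (eqVneq k i) => _ //=; case: (nat_of_ord r) => [|?] // _.
by case: ifP => // _; case: ifP => //; case: ifP.
Qed.

Lemma eta2_homog sigma j k l (b : mor K k l) (a : mor K j k) :
  tw_homog (-1) (eta2 i sigma b a).
Proof.
move=> r c; rewrite dg_braid !mxE eta2E // /eta2_val /=.
by case: (eqVneq l i) => _ //=; case: (nat_of_ord r).
Qed.

Lemma eta_prenat sigma : is_prenat 1 (eta_nat i sigma).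
Proof.
split=> [x u v y c1 c2 t a b | x y c].
  case: c1 a b => [x0|x0 x1 y0 d c1] a b /=.
    case: c2 a b => [x2|x2 x3 y2 e c2] a b /=; first exact: eta1_linear.
    case: c2 e => [x4|? ? ? ? ?] e /=; last by rewrite scaler0 addr0.
    exact: eta2_linear_r.
  case: c1 d a b => [x2|x2 x3 y2 e c1] d a b /=; last first.
    by case: c1 e a b => [?|? ? ? ? ?] /=; rewrite scaler0 addr0.
  case: c2 a b => [x4|? ? ? ? ?] a b /=; last by rewrite scaler0 addr0.
  exact: eta2_linear_l.
case: c => [x0|x0 x1 y0 a c] /=; first exact: homog0.
case: c a => [x2|x2 x3 y1 b c] a /=; first exact: eta1_homog.
case: c b => [x4|? ? ? ? ?] b /=; first exact: eta2_homog.
exact: homog0.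
Qed.

Lemma eta_nat_linear t sigma tau :
  eta_nat i (t *: sigma + tau) = t *: eta_nat i sigma + eta_nat i tau.
Proof.
apply: cochainP => x y c.
rewrite -[RHS]/(t%:P *: eta_nat i sigma c + eta_nat i tau c).
case: c => [x0|x0 x1 y0 a c] /=; first by rewrite scaler0 addr0.
case: c a => [x2|x2 x3 y1 b c] a /=.
  apply/matrixP => r c; rewrite !mxE !eta1E /eta1_val -!mul_polyC.
  by do ![case: ifP => _]; rewrite ?(mulr0, addr0) //; ring.
case: c b => [x4|? ? ? ? ?] b /=; last by rewrite scaler0 addr0.
apply/matrixP => r c; rewrite !mxE !eta2E /eta2_val -!mul_polyC.
by do ![case: ifP => _]; rewrite ?(mulr0, addr0) //; ring.
Qed.

Hypotheses (i_gt0 : (0 < i)%N) (i_ltN : (i < N)%N) (two_neq0 : 2 != 0 :> K).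

(** It suffices to compare the augmentations and the entries in [T_{i-1}] of the
    equation on strings of length 2. The augmentations agree because [sigma_der]
    is a derivation, and the other entries because of the values of [lam]. *)
Lemma eta_nat_trans sigma : is_nat_trans 1 (eta_nat i sigma).
Proof.
apply: nat_transP => //; first exact: eta_prenat.
move=> x y z a b /=.
apply/eqP; rewrite -subr_eq0; apply/eqP; apply: emb_col_eq0.
- rewrite mulmxBr mulmxA top_dif_mx mul0mx sub0r.
  rewrite -emb_col_comp -emb_col_single -emb_colD -emb_colN -emb_colD.
  rewrite homog0_top ?oppr0 //.
  apply: homogD; [apply: homogD|by apply: homogN; exact: eta1_homog].
    have := twcomp_homog (@beta1_homog K N i y z b) (@eta1_homog sigma x y a).
    by rewrite addr0.
  have := twcomp_homog (@eta1_homog sigma y z b) (single_homog a).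
  by rewrite addr0.
- apply: scaleX_inj; rewrite !(mulmxBr, mulmxDr) mulmxA mid_dif_mx !(scalerBr, scalerDr).
  have Eb : 'X *: (mid_row K i z *m (emb a *: emb_col (eta1 i sigma b))) =
            emb a *: (if z == i then lam K i y * sigma_der sigma b else 0)%:M.
    by rewrite -scalemxAr scalerA mulrC -scalerA eta1_mid.
  rewrite eta2_top // Eb eta1_mid // mulmxA scalemxAl mid_beta1 //.
  case: (eqVneq z i) => [zi|zi] /=; last first.
    by rewrite mul0mx; apply/matrixP => r c; rewrite !mxE; ring.
  case: (eqVneq y i) => [yi|yi] /=.
    rewrite -scalemxAl (mulrC 'X) -scalerA eta1_mid // yi eqxx.
    by apply/matrixP => r c; rewrite !mxE sigma_der_comp; ring.
  rewrite -scalemxAl eta1_aug //.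
  by apply/matrixP => r c; rewrite !mxE sigma_der_comp; ring.
- rewrite !(mulmxBr, mulmxDr) mulmxA aug_dif_mx mul0mx mulmxA aug_beta1 //.
  rewrite -scalemxAl -scalemxAr !eta1_aug // sigma_der_comp.
  by apply/matrixP => r c; rewrite !mxE; ring.
Qed.

End EtaCocycle.

(** * Derivations of the category *)
Section Derivations.
Variables (K : fieldType) (N : nat).
Implicit Types (x y z : 'I_N.+1).

(** A map [a] out of [T_x] can be precomposed with the generator from [T_i] to
    [T_x], which is not a zero divisor, and every map out of [T_i] is a generator
    times a polynomial in [s_i]. *)
Lemma derivation_eq0 i (D : forall x y, mor K x y -> {poly K}) :
  (forall x y t (a b : mor K x y), D x y (t *: a + b) = t *: D x y a + D x y b) ->
  (forall x y z (a : mor K x y) (b : mor K y z),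
     D x z (mor_comp b a) = emb b * D x y a + emb a * D y z b) ->
  (forall y, D i y (1 : {poly K}) = 0) -> D i i ('X : {poly K}) = 0 ->
  forall x y (a : mor K x y), D x y a = 0.
Proof.
move=> lin leib D1 DX.
have delta_l (y : nat) : delta i i y = 0%N by rewrite /delta /ndist; lia.
have Di (p : mor K i i) : D i i p = 0.
  elim/poly_ind: (p : {poly K}) => [|q c IH].
    have:= lin i i (-1) (0 : {poly K}) (0 : {poly K}).
    by rewrite scaler0 add0r scaleN1r addNr.
  have -> : q * 'X + c%:P = c *: (1 : {poly K}) + @mor_comp K N i i i q ('X : {poly K}).
    by rewrite /mor_comp delta_l mul1r -alg_polyC addrC.
  by rewrite lin D1 scaler0 add0r leib DX IH !mulr0 addr0.
have Diy y (p : mor K i y) : D i y p = 0.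
  have -> : p = @mor_comp K N i i y (1 : {poly K}) (p : {poly K}).
    by rewrite /mor_comp delta_l !mul1r.
  by rewrite leib D1 Di !mulr0 addr0.
move=> x y a.
have:= leib i x y (1 : {poly K}) a; rewrite !Diy mulr0 add0r => /esym/eqP.
by rewrite mulf_eq0 /emb mulr1 (negbTE (weight_neq0 _ _ _)) => /eqP.
Qed.

End Derivations.

(** * Classification of the cocycles *)
Section Main.
Variables (K : fieldType) (N : nat) (i : 'I_N.+1).
Hypotheses (i_gt0 : (0 < i)%N) (i_ltN : (i < N)%N) (two_neq0 : 2 != 0 :> K).
Implicit Types (j k l x y z : 'I_N.+1) (sigma : {poly K}).
Notation B := (braid_obj K i).
Notation cochain := (cochain (braid K i)).

Definition primitive (h0 : forall x, twmor (single K x) (B x))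
    (h1 : forall x y, mor K x y -> twmor (single K x) (B y)) : cochain :=
  fun x y c => match c in chain _ x y return twmor (single K x) (B y) with
  | nilc x0 => h0 x0
  | consc x0 x1 y0 a c' =>
    match c' in chain _ x1 y0 return mor K x0 x1 -> twmor (single K x0) (B y0) with
    | nilc _ => fun a => h1 _ _ a
    | consc _ _ _ _ _ => fun _ => 0
    end a
  end.

Lemma primitive_prenat h0 h1 :
  (forall x, tw_homog 0 (h0 x)) -> (forall x y a, tw_homog (-1) (h1 x y a)) ->
  (forall x y t a b, h1 x y (t *: a + b) = t%:P *: h1 x y a + h1 x y b) ->
  is_prenat 0 (primitive h0 h1).
Proof.
move=> h0D h1D h1P; split=> [x u v y c1 c2 t a b | x y c].
  case: c1 a b => [x0|x0 x1 y0 d c1] a b /=.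
    case: c2 a b => [x2|x2 x3 y2 e c2] a b /=; first exact: h1P.
    by rewrite scaler0 addr0.
  by case: c1 d a b => [x2|x2 x3 y2 e c1] d a b /=; rewrite scaler0 addr0.
case: c => [x0|x0 x1 y0 a c] /=; first by rewrite subrr.
case: c a => [x2|x2 x3 y1 b c] a /=; last exact: homog0.
exact: h1D.
Qed.

Lemma aug_weight j k (f : twmor (single K j) (B k)) : k != i ->
  exists d, aug K i k *m emb_col f = (weight K j k * d)%:M.
Proof.
move=> ki; have [F E] := row_emb_col i_gt0 i_ltN f.
by exists (F 0); rewrite /aug E (negbTE ki) /aug_entry (negbTE ki) mul1r.
Qed.

(** The augmentation at [i] has its image in the ideal (u, v), whose part of
    weight zero is generated by [s]. *)
Lemma aug_weight_i (f : twmor (single K i) (B i)) :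
  exists d, aug K i i *m emb_col f = ('X * d)%:M.
Proof.
have [F E] := row_emb_col i_gt0 i_ltN f; exists (weight K i i.-1 * F 1 + weight K i i * F 2).
rewrite /aug E eqxx /aug_entry eqxx /= -(weight_succ K (leqnn i)).
by congr (_%:M); ring.
Qed.

Lemma sigma_der_unit sigma j k : sigma_der sigma ((1 : {poly K}) : mor K j k) =
  weight K j k * (2^-1 *: sigma *+ ndist j k).
Proof.
have d1 : (1 : {poly K})^`() = 0 by rewrite -polyC1 derivC.
rewrite /sigma_der /emb -weight_euler /euler d1 mulr0 mul0rn add0r mulr1.
by rewrite -pmulrn mulr_natr !mulrnAr mulrC.
Qed.

Lemma sigma_der_X sigma : sigma_der sigma ('X : mor K i i) = 'X * sigma.
Proof.
rewrite /sigma_der /emb subrr /weight subnn expr0 mul1r /euler mul0r addr0 derivX mulr1.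
by rewrite mulrnAr -mulrnAl -scaler_nat scalerA divff // scale1r mulrC.
Qed.

(** The augmentation of a coboundary is an inner derivation. *)
Lemma aug_mu1 (h : cochain) x y (a : mor K x y) :
  aug K i y *m emb_col (mu1 0 h (consc a (nilc K y)) : twmor (single K x) (B y)) =
  emb a *: (aug K i x *m emb_col (h _ _ (nilc K x)) - aug K i y *m emb_col (h _ _ (nilc K y))).
Proof.
rewrite coboundary_1 // !mulmxBr !mulmxA aug_dif_mx mul0mx subr0 aug_beta1 //.
by rewrite -scalemxAl -scalemxAr scalerBr.
Qed.

(** An inner derivation vanishes on [s_i], whereas the derivation of [sigma]
    takes the value [s_i sigma] there. *)
Lemma eta_inj sigma (h : cochain) : eta_nat i sigma = mu1 0 h -> sigma = 0.
Proof.
move=> E.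
have := aug_mu1 h ('X : mor K i i); rewrite -E /= eta1_aug // subrr scaler0.
move=> /matrixP/(_ ord0 ord0); rewrite !mxE sigma_der_X mulr1n => /eqP.
by rewrite mulf_eq0 polyX_eq0 => /eqP.
Qed.

Definition aug_of (f : cochain) x y (a : mor K x y) : {poly K} :=
  (aug K i y *m emb_col (f _ _ (consc a (nilc K y)))) ord0 ord0.

Lemma aug_ofE (f : cochain) x y (a : mor K x y) :
  aug K i y *m emb_col (f _ _ (consc a (nilc K y))) = (aug_of f a)%:M.
Proof. by apply/matrixP => r c; rewrite (ord1 r) (ord1 c) [RHS]mxE mulr1n. Qed.

Lemma prenat_linear_1 (f : cochain) x y t (a b : mor K x y) : is_prenat 1 f ->
  f _ _ (consc (t *: a + b) (nilc K y)) =
    t%:P *: f _ _ (consc a (nilc K y)) + f _ _ (consc b (nilc K y)).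
Proof. by move=> fP; exact: (fP.1 _ _ _ _ (nilc K x) (nilc K y)). Qed.

Lemma aug_of_linear (f : cochain) x y t (a b : mor K x y) : is_prenat 1 f ->
  aug_of f (t *: a + b) = t *: aug_of f a + aug_of f b.
Proof.
move=> fP; rewrite /aug_of prenat_linear_1 // emb_colD emb_colZ mulmxDr.
by rewrite -scalemxAr !mxE mul_polyC.
Qed.

(** Augmenting the cocycle equation on two composable maps removes its only
    term from degree two, since the augmentation kills the differential of the
    cone. What remains is the Leibniz rule. *)
Lemma aug_of_leibniz (f : cochain) x y z (a : mor K x y) (b : mor K y z) :
  is_nat_trans 1 f ->
  aug_of f (mor_comp b a) = emb b * aug_of f a + emb a * aug_of f b.
Proof.
move=> [fP f0].
have : aug K i z *m emb_col (mu1 1 f (consc a (consc b (nilc K z)))) = 0.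
  by rewrite f0; apply/matrixP => r c; rewrite !mxE big1 // => m _; rewrite !mxE !mulr0.
rewrite cocycle_2 // !(mulmxDr, mulmxN) !mulmxA aug_dif_mx mul0mx aug_beta1 // subr0.
rewrite -scalemxAl -scalemxAr !aug_ofE => /matrixP/(_ ord0 ord0); rewrite !mxE !mulr1n.
by move/eqP; rewrite subr_eq0 => /eqP.
Qed.

(** If the derivation attached to a cocycle is the commutator with a family of
    scalars [r], then [r], viewed as a degree 0 family of maps from [T_j] to its
    image, gives a primitive up to a term that the augmentation kills. That term
    is a boundary in the cone, and its preimages correct the primitive. The
    scalar at [i] is normalised to 0 because the identity of [T_i] does not lift
    to the degree 0 part of the cone. *)
Lemma inner_coboundary (f : cochain) (r : 'I_N.+1 -> {poly K}) :
  is_nat_trans 1 f -> r i = 0 ->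
  (forall x y (a : mor K x y), aug_of f a = emb a * (r x - r y)) ->
  exists2 h : cochain, is_prenat 0 h & f = mu1 0 h.
Proof.
move=> fN ri fr; have [fP _] := fN.
pose h0 j : twmor (single K j) (B j) := const_mx (r j).
have h0D j : tw_homog 0 (h0 j).
  move=> s c; rewrite dg_braid !mxE /=; case: (eqVneq j i) => [E|_] //=.
  by rewrite (congr1 r E) ri.
have h0_aug j : aug K i j *m emb_col (h0 j) = (r j)%:M.
  apply/matrixP => s c; rewrite (ord1 s) (ord1 c) !mxE mulr1n.
  under eq_bigr do rewrite !mxE.
  have [E|ji] := eqVneq j i.
    by rewrite (congr1 r E) ri big1 // => m _; rewrite !mulr0.
  under eq_bigr do rewrite ob_braid_nat //.
  rewrite (sum_braid i j (fun m => aug_entry K i j m *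
    (weight K j (if j == i then nth (i : nat) [:: (i : nat); i.-1; i.+1] m else j) * r j))).
  by rewrite /aug_entry (negbTE ji) /weight subnn expr0 !mul1r.
(* The defect of [h0] alone as a primitive of [f]. *)
pose w x y (a : mor K x y) : twmor (single K x) (B y) :=
  twcomp (beta1 i a) (h0 x) - twcomp (h0 y) (single_mor a) - f _ _ (consc a (nilc K y)).
have emb_w x y (a : mor K x y) : emb_col (w x y a) =
    emb_mx (beta1 i a) *m emb_col (h0 x) - emb a *: emb_col (h0 y)
    - emb_col (f _ _ (consc a (nilc K y))).
  by rewrite /w !emb_colD !emb_colN emb_col_single emb_col_comp.
have wD x y (a : mor K x y) : tw_homog 0 (w x y a).
  apply: homogD; last by apply: homogN; exact: prenat1_1.
  apply: homogD; last apply: homogN.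
    have:= twcomp_homog (@beta1_homog K N i x y a) (h0D x); by rewrite addr0.
  have:= twcomp_homog (h0D y) (single_homog a); by rewrite addr0.
have w_lin x y t (a b : mor K x y) : w x y (t *: a + b) = t%:P *: w x y a + w x y b.
  rewrite /w prenat_linear_1 // beta1_linear single_mor_linear twcomp_linear_l twcomp_linear_r.
  by apply/matrixP => s c; rewrite !mxE; ring.
have w_aug x y (a : mor K x y) : aug K i y *m emb_col (w x y a) = 0.
  rewrite emb_w !(mulmxDr, mulmxN) mulmxA aug_beta1 //.
  rewrite -scalemxAl -scalemxAr !h0_aug aug_ofE fr.
  by apply/matrixP => s c; rewrite (ord1 s) (ord1 c) !mxE !mulr1n; ring.
pose ex_h1 x y (a : mor K x y) := cid2 (dif_mx_exact i_gt0 i_ltN (wD x y a) (w_aug x y a)).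
pose h1 x y (a : mor K x y) : twmor (single K x) (B y) := s2val (ex_h1 x y a).
have h1D x y a : tw_homog (-1) (h1 x y a) by exact: (s2valP (ex_h1 x y a)).
have h1E x y a : dif_mx K i y *m emb_col (h1 x y a) = emb_col (w x y a).
  exact: (s2valP' (ex_h1 x y a)).
(* The preimages are chosen one at a time; uniqueness makes them linear. *)
have h1_lin x y t a b : h1 x y (t *: a + b) = t%:P *: h1 x y a + h1 x y b.
  apply/eqP; rewrite -subr_eq0; apply/eqP; apply: homogN1_inj.
    by apply: homogD; [exact: h1D | apply: homogN; apply: homog_linear; exact: h1D].
  rewrite emb_colD emb_colN emb_colD emb_colZ !(mulmxDr, mulmxN) -scalemxAr !h1E w_lin.
  by rewrite emb_colD emb_colZ subrr.
exists (primitive h0 h1); first exact: primitive_prenat.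
apply: cocycle_eq_coboundary => // [|x y a]; first exact: primitive_prenat.
by rewrite coboundary_1 //= h1E emb_w subKr.
Qed.

(** The derivation attached to [f] is normalised on the maps out of [T_i]. Its
    value on [s_i] is divisible by ['X] and defines [sigma]; its values on the
    generators [a_{ji}] differ from those of the derivation of [sigma] by
    multiples of [a_{ji}], which a commutator absorbs. *)
Lemma eta_surj (f : cochain) : is_nat_trans 1 f ->
  exists sigma, exists2 h : cochain, is_prenat 0 h & f - eta_nat i sigma = mu1 0 h.
Proof.
move=> fN; have [fP _] := fN.
have [sigma sE] : exists sigma, aug_of f ('X : mor K i i) = 'X * sigma.
  have [d E] := aug_weight_i (f _ _ (consc ('X : mor K i i) (nilc K i))).
  by exists d; rewrite /aug_of E mxE mulr1n.
have D1 : aug_of f (1%R : mor K i i) = 0.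
  have:= @aug_of_leibniz f i i i (1 : {poly K}) (1 : {poly K}) fN.
  rewrite /mor_comp /delta /ndist subrr /= expr0 !mulr1 /emb /weight subnn expr0 !mul1r.
  by move=> /eqP; rewrite -subr_eq0 opprD addrA subrr add0r oppr_eq0 => /eqP.
have [d dE] : exists d : 'I_N.+1 -> {poly K}, forall j,
    aug_of f ((1 : {poly K}) : mor K i j) = weight K i j * d j /\ (j = i -> d j = 0).
  apply: (@fin_all_exists _ (fun _ => {poly K}) (fun j d =>
    aug_of f ((1 : {poly K}) : mor K i j) = weight K i j * d /\ (j = i -> d = 0))) => j.
  case: (eqVneq j i) => [->|ji]; first by exists 0; rewrite D1 mulr0.
  have [d E] := aug_weight (f _ _ (consc ((1 : {poly K}) : mor K i j) (nilc K j))) ji.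
  by exists d; rewrite /aug_of E mxE mulr1n; split=> // /eqP; rewrite (negbTE ji).
exists sigma; pose f' : cochain := f - eta_nat i sigma.
have f'N : is_nat_trans 1 f'.
  pose f1 := mk_nat_trans fN.
  pose f2 := mk_nat_trans (eta_nat_trans i_gt0 i_ltN two_neq0 sigma).
  exact/asboolP/(nat_trans_valP (f1 - f2)).
have f'E x y (a : mor K x y) : aug_of f' a = aug_of f a - sigma_der sigma a.
  rewrite /aug_of -[f' _ _ _]/(f _ _ (consc a (nilc K y)) - eta1 i sigma a).
  by rewrite emb_colD emb_colN mulmxDr mulmxN eta1_aug // !mxE mulr1n.
pose r j := 2^-1 *: sigma *+ ndist i j - d j.
have ri : r i = 0 by rewrite /r (dE i).2 // /ndist subrr mulr0n subr0.
apply: (inner_coboundary f'N ri) => x y a; apply/eqP; rewrite -subr_eq0; apply/eqP.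
rewrite f'E; move: x y a; apply: (derivation_eq0 (i := i)).
- move=> x y t a b; rewrite aug_of_linear // /sigma_der emb_linear euler_is_linear.
  by rewrite -!mul_polyC; ring.
- by move=> x y z a b; rewrite aug_of_leibniz // sigma_der_comp emb_comp; ring.
- by move=> y; rewrite (dE y).1 sigma_der_unit // ri /emb /r; ring.
- by rewrite sE sigma_der_X // /emb /weight subnn expr0; ring.
Qed.

End Main.

Theorem theorem9p9 (K : fieldType) (N : nat) (i : 'I_N.+1)
  (hchar : 2%N \notin [pchar K]) (hN : (2 <= N)%N) (hi : (1 <= i <= N - 1)%N) :
  exists (hnat : forall sigma : {poly K}, is_nat_trans 1 (eta_nat i sigma))
         (Phi : {linear {poly K} -> HH (braid K i) 1}),
    (forall sigma, Phi sigma = HH_class (mk_nat_trans (hnat sigma))) /\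
    bijective Phi.
Proof.
have i_gt0 : (0 < i)%N by case/andP: hi.
have i_ltN : (i < N)%N by lia.
have two_neq0 : 2 != 0 :> K by move: hchar; rewrite !inE.
pose hnat := eta_nat_trans i_gt0 i_ltN two_neq0.
pose phi sigma : HH (braid K i) 1 := HH_class (mk_nat_trans (hnat sigma)).
have phi_lin : linear phi.
  move=> t sigma tau; rewrite /phi -HH_class_linear; congr HH_class.
  by apply: val_inj => /=; exact: eta_nat_linear.
pose Phi : {linear {poly K} -> HH (braid K i) 1} :=
  HB.pack phi (GRing.isLinear.Build K _ _ _ phi phi_lin).
exists hnat, Phi; split=> //.
have phi_inj : injective phi.
  move=> sigma tau /HH_class_eqP-[h _ E]; apply/eqP; rewrite -subr_eq0; apply/eqP.
  apply: (eta_inj (h := h) i_gt0 i_ltN two_neq0).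
  rewrite -[sigma - tau]addrC -scaleN1r eta_nat_linear // scaleN1r addrC.
  by move: E; rewrite subrr.
have phi_surj c : exists sigma, phi sigma = c.
  elim/quotW: c => f.
  have [sigma [h hP E]] := eta_surj i_gt0 i_ltN two_neq0 (asboolW (nat_trans_valP f)).
  exists sigma; apply/esym/HH_class_eqP; exists h; first by rewrite subrr.
  by rewrite [in RHS]subrr -E.
exists (fun c => projT1 (cid (phi_surj c))) => [sigma | c]; last by case: cid.
by apply: phi_inj; case: cid.
Qed.
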